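(* Let $s\in(0,1)$, let $\Omega\subset\mathbb{R}^N$ be a bounded strictly convex domain of class $C^2$, and let $f\in C(\overline\Omega)$ and $g\in C(\overline{\mathbb{R}^N\setminus\Omega})$ be bounded. Let $u,v\colon\mathbb{R}^N\to\mathbb{R}$ be, respectively, a viscosity subsolution and a viscosity supersolution (in the sense described in the context) of \[ \begin{cases} \displaystyle \Lambda_1^s u(x)\coloneqq \inf\left\{\int_{\mathbb{R}}\frac{u(x+tz)-u(x)}{|t|^{1+2s}}\,dt\colon z\in\mathbb{S}^{N-1}\right\}=f(x), & x\in\Omega,\\[6pt] u(x)=g(x), & x\in\mathbb{R}^N\setminus\Omega. \end{cases} \] Then $u\le v$ in $\mathbb{R}^N$.
   Context: Integrals are principal value integrals; $\mathbb{S}^{N-1}$ is the unit sphere. For $u\colon\overline\Omega\to\mathbb{R}$ let the upper $g$-extension be $u^g=u$ in $\Omega$, $u^g=g$ in $\mathbb{R}^N\setminus\overline\Omega$, $u^g=\max\{u,g\}$ on $\partial\Omega$; the lower $g$-extension $u_g$ uses $\min$ instead. For $\delta>0$, $z\in\mathbb{S}^{N-1}$, a $C^2$ function $\phi$ and a function $w$, set $E_{z,\delta}(w,\phi,x)\coloneqq\int_{-\delta}^{\delta}\frac{\phi(x+tz)-\phi(x)}{|t|^{1+2s}}dt+\int_{\mathbb{R}\setminus(-\delta,\delta)}\frac{w(x+tz)-u(x)}{|t|^{1+2s}}dt-f(x)$ and $E_\delta(w,\phi,x)\coloneqq-\inf_{z\in\mathbb{S}^{N-1}}E_{z,\delta}(w,\phi,x)$.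 A bounded upper semicontinuous $u\colon\mathbb{R}^N\to\mathbb{R}$ is a viscosity subsolution if $u\le g$ in $\mathbb{R}^N\setminus\overline\Omega$ and for every $\delta>0$ and $\phi\in C^2(\mathbb{R}^N)$ such that $x_0$ is a maximum point of $u-\phi$ in $B_\delta(x_0)$: $E_\delta(u^g,\phi,x_0)\le0$ if $x_0\in\Omega$, and $\min\{E_\delta(u^g,\phi,x_0),u(x_0)-g(x_0)\}\le 0$ if $x_0\in\partial\Omega$ (if $u$ is not upper semicontinuous, this is required of its upper semicontinuous envelope). Viscosity supersolutions are defined analogously, with lower semicontinuity, $u_g$, minimum points and reversed inequalities (with $\max$ instead of $\min$ on $\partial\Omega$). *)

(* Defs.v *)
From HB Require Import structures.
From mathcomp Require Import all_boot all_order all_algebra.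
From mathcomp Require Import all_classical all_reals all_analysis.
Set Implicit Arguments. Unset Strict Implicit. Unset Printing Implicit Defensive.
Import Order.TTheory GRing.Theory Num.Theory.
Import numFieldNormedType.Exports.
Local Open Scope classical_set_scope.
Local Open Scope ring_scope.

Section Defs.
Variables (R : realType) (N : nat).
Notation V := 'rV[R]_N.

Definition enorm (x : V) : R := Num.sqrt (\sum_(i < N) x 0 i ^+ 2).
Definition eball (x : V) (r : R) : set V := [set y | enorm (y - x) < r].
Definition sphere : set V := [set z | enorm z = 1].

Definition evec (i : 'I_N) : V := \row_(j < N) (i == j)%:R.

Definition C2 (f : V -> R) : Prop :=
  continuous f /\
  (forall i x, derivable f x (evec i)) /\
  (forall i, continuous (fun x => 'D_(evec i) f x)) /\
  (forall i j x, derivable (fun y => 'D_(evec i) f y) x (evec j)) /\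
  (forall i j, continuous (fun x => 'D_(evec j) (fun y => 'D_(evec i) f y) x)).

Definition ebounded (A : set V) : Prop :=
  exists M : R, forall x, A x -> enorm x <= M.

(* a bounded (nonempty, open, connected) domain with C^2 boundary:
   near every boundary point, after an orthogonal change of coordinates Q,
   Omega is the supergraph (in the i-th coordinate) of a C^2 function of the
   remaining N-1 coordinates *)
Definition C2_boundary (Om : set V) : Prop :=
  forall x0, (closure Om `\` Om) x0 ->
  exists (Q : 'M[R]_N) (i : 'I_N) (r : R) (gam : V -> R),
    Q *m Q^T = 1%:M /\ 0 < r /\ C2 gam /\
    (forall y a, gam y = gam (y + a *: evec i)) /\
    (forall x, eball x0 r x ->
       (Om x <-> (x *m Q) 0 i > gam (x *m Q))).

Definition bounded_C2_domain (Om : set V) : Prop :=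
  Om !=set0 /\ open Om /\ connected Om /\ ebounded Om /\ C2_boundary Om.

Definition strictly_convex (Om : set V) : Prop :=
  forall x y (l : R), closure Om x -> closure Om y -> x != y ->
    0 < l < 1 -> Om ((1 - l) *: x + l *: y).

Definition bounded_on (A : set V) (h : V -> R) : Prop :=
  exists M : R, forall x, A x -> `|h x| <= M.

Definition pv_int (A : set R) (F : R -> R) : R :=
  lim ((fun e : R =>
     (\int[@lebesgue_measure R]_(t in A `&` [set t | e < `|t| < e^-1]) F t))
     @ (0 : R)^'+).

Definition kern (s t : R) : R := (powR `|t| (1 + 2 * s))^-1.

(* E_{z,delta}(w, phi, x), ux playing the role of u(x) *)
Definition Ezd (s : R) (f : V -> R) (z : V) (d : R) (w : V -> R) (ux : R)
    (phi : V -> R) (x : V) : R :=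
  pv_int `[- d, d] (fun t => (phi (x + t *: z) - phi x) * kern s t)
  + pv_int (~` `]- d, d[) (fun t => (w (x + t *: z) - ux) * kern s t)
  - f x.

Definition Ed (s : R) (f : V -> R) (d : R) (w : V -> R) (ux : R)
    (phi : V -> R) (x : V) : R :=
  - inf [set Ezd s f z d w ux phi x | z in sphere].

Definition up_ext (Om : set V) (g u : V -> R) (x : V) : R :=
  if `[< Om x >] then u x
  else if `[< closure Om x >] then Num.max (u x) (g x) else g x.
Definition low_ext (Om : set V) (g u : V -> R) (x : V) : R :=
  if `[< Om x >] then u x
  else if `[< closure Om x >] then Num.min (u x) (g x) else g x.

(* upper / lower semicontinuous envelopes (of a bounded function) *)
Definition usc_env (u : V -> R) (x : V) : R :=
  inf [set sup [set u y | y in eball x r] | r in [set r : R | 0 < r]].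
Definition lsc_env (u : V -> R) (x : V) : R :=
  sup [set inf [set u y | y in eball x r] | r in [set r : R | 0 < r]].

Definition visc_sub_usc (s : R) (Om : set V) (f g : V -> R) (u : V -> R) :=
  (forall x, ~ closure Om x -> u x <= g x) /\
  forall (d : R) (phi : V -> R) (x0 : V), 0 < d -> C2 phi ->
    (forall y, eball x0 d y -> u y - phi y <= u x0 - phi x0) ->
    (Om x0 -> Ed s f d (up_ext Om g u) (u x0) phi x0 <= 0) /\
    ((closure Om `\` Om) x0 ->
       Num.min (Ed s f d (up_ext Om g u) (u x0) phi x0) (u x0 - g x0) <= 0).

Definition visc_super_lsc (s : R) (Om : set V) (f g : V -> R) (v : V -> R) :=
  (forall x, ~ closure Om x -> v x >= g x) /\
  forall (d : R) (phi : V -> R) (x0 : V), 0 < d -> C2 phi ->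
    (forall y, eball x0 d y -> v y - phi y >= v x0 - phi x0) ->
    (Om x0 -> Ed s f d (low_ext Om g v) (v x0) phi x0 >= 0) /\
    ((closure Om `\` Om) x0 ->
       Num.max (Ed s f d (low_ext Om g v) (v x0) phi x0) (v x0 - g x0) >= 0).

(* viscosity sub/supersolution: bounded, and the condition is imposed on the
   upper (resp. lower) semicontinuous envelope (which is the function itself
   when it is already usc (resp. lsc)) *)
Definition visc_subsolution s Om f g (u : V -> R) : Prop :=
  bounded_on setT u /\ visc_sub_usc s Om f g (usc_env u).
Definition visc_supersolution s Om f g (v : V -> R) : Prop :=
  bounded_on setT v /\ visc_super_lsc s Om f g (lsc_env v).

End Defs.

(* Main.v *)
(* Let [u'], [v'] be the semicontinuous envelopes of [u] and [v].

   First, [u' <= g <= v'] on the boundary. If [v' x0 < g x0] at a boundary point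
   [x0] with inner normal [k], minimise [v' + K <k, . - x0>] over the closure of
   [Om] for a large [K]. By strict convexity the caps cut off by hyperplanes
   parallel to the supporting one shrink to [x0], so the minimiser [y] is close
   to [x0] and [K <k, y - x0>] is small. The affine test function at [y] is
   cancelled by the symmetry of the principal value, while every line through [y]
   leaves the closure on at least one side at a small distance [P], beyond which
   the exterior datum exceeds [v' y] by a fixed amount. The resulting gain, of
   order [P^(-2s)], contradicts the supersolution inequality in all directions.

   Second, the extensions [A] and [B] of [u'] and [v'] by [g] are semicontinuous
   and coincide outside [Om]. If [m := sup (A - B) > 0], double the variables:
   maximise [A x - B y - n |x - y|^2]. As [n] grows the maximisers stay at a
   positive distance from the complement of [Om], and along any line the
   increment [A (x + tz) - B (y + tz) - (A x - B y)] is nonpositive for small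
   [t], at most [o(1)] on bounded sets, and at most [- m + o(1)] once [x + tz]
   has left the bounded set [Om]. Hence the difference of the two nonlocal terms
   is bounded above by a negative constant, which contradicts the two
   inequalities and the continuity of [f]. *)

Require Import Defs.
From HB Require Import structures.
From mathcomp Require Import all_boot all_order all_algebra.
From mathcomp Require Import all_classical all_reals all_analysis.
From mathcomp Require Import measurable_realfun.
From mathcomp Require Import ring lra.
Import Order.TTheory GRing.Theory Num.Theory.
Import numFieldNormedType.Exports.
Local Open Scope classical_set_scope.
Local Open Scope ring_scope.
Set Implicit Arguments.
Unset Strict Implicit.
Unset Printing Implicit Defensive.

(** * Real powers, the kernel, and reflection of integrals on the line *)

Section Kernel.
Variable R : realType.
Implicit Types (a b c d e p s t : R) (F H : R -> R).

Local Notation mu := (@lebesgue_measure R).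

Lemma le_powR_neg p a b : 0 <= p -> 0 < a -> a <= b -> b `^ (- p) <= a `^ (- p).
Proof.
move=> p0 a0 ab; have b0 := lt_le_trans a0 ab.
rewrite !powRN lef_pV2 ?posrE ?powR_gt0//.
by apply: ge0_ler_powR => //; rewrite nnegrE ltW.
Qed.

Lemma powR_neg_le_near_infty p e : 0 < p -> 0 < e ->
  exists2 X, 0 < X & forall x, X <= x -> x `^ (- p) <= e.
Proof.
move=> p0 e0; exists (e `^ (- p^-1)) => [|x Xx]; first exact: powR_gt0.
apply: le_trans (le_powR_neg _ (powR_gt0 _ e0) Xx) _; first exact: ltW.
by rewrite -powRrM mulrNN mulVf ?gt_eqF// powRr1// ltW.
Qed.

Lemma powR_neg_ge_near0 p (M : R) : 0 < p ->
  exists2 r, 0 < r & forall x, 0 < x -> x <= r -> M <= x `^ (- p).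
Proof.
move=> p0; have M1 : 0 < Num.max M 1 by rewrite lt_max ltr01 orbT.
exists (Num.max M 1 `^ (- p^-1)) => [|x x0 xr]; first exact: powR_gt0.
apply: le_trans (le_powR_neg (ltW p0) x0 xr).
by rewrite -powRrM mulrNN mulVf ?gt_eqF// powRr1 ?(ltW M1)// le_max lexx.
Qed.

Lemma powR_le_near0 p e : 0 < p -> 0 < e ->
  exists2 r, 0 < r & forall x, 0 < x -> x <= r -> x `^ p <= e.
Proof.
move=> p0 e0; exists (e `^ p^-1) => [|x x0 xr]; first exact: powR_gt0.
apply: (@le_trans _ _ ((e `^ p^-1) `^ p)).
  by apply: ge0_ler_powR => //; rewrite ?nnegrE ?powR_ge0// ltW.
by rewrite -powRrM mulVf ?gt_eqF// powRr1// ltW.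
Qed.

Lemma kern_ge0 s t : 0 <= kern s t.
Proof. by rewrite /kern invr_ge0 powR_ge0. Qed.

Lemma kernN s t : kern s (- t) = kern s t.
Proof. by rewrite /kern normrN. Qed.

Lemma kernE s t : 0 < t -> kern s t = t `^ (- (1 + 2 * s)).
Proof. by move=> t0; rewrite /kern gtr0_norm// powRN. Qed.

Lemma measurable_kern s : measurable_fun setT (kern s).
Proof.
apply: (eq_measurable_fun (fun t => `|t| `^ (- (1 + 2 * s)))).
  by move=> t _; rewrite /kern powRN.
exact: (measurableT_comp (@measurable_powR _ _)).

Qed.

Lemma continuous_powR_at p a : 0 < a -> {for a, continuous (fun x : R => x `^ p)}.
Proof.
move=> a0; apply: differentiable_continuous; apply/derivable1_diffP.
by apply: derivable_powR; rewrite in_itv/= a0.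
Qed.

Lemma integral_kern_half s a : 0 < s -> 0 < a ->
  (\int[mu]_(t in `[a, +oo[) (kern s t)%:E = (a `^ (- (2 * s)) / (2 * s))%:E)%E.
Proof.
move=> s0 a0; have s20 : 2 * s != 0 by rewrite gt_eqF// mulr_gt0.
pose F t := (- (2 * s)^-1) * t `^ (- (2 * s)).
have dF t : 0 < t -> is_derive t 1 F (t `^ (- (1 + 2 * s))).
  move=> t0; have := is_derive1_powR (- (2 * s)) t0 => dp.
  rewrite /F; apply: is_derive_eq.
  rewrite /GRing.scale/= mulrA mulrNN mulVf// mul1r; congr powR; ring.
transitivity (\int[mu]_(t in `[a, +oo[) (t `^ (- (1 + 2 * s)))%:E)%E.
  apply: eq_integral => t; rewrite inE/= in_itv/= andbT => at_.
  by rewrite kernE// (lt_le_trans a0).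
rewrite (@ge0_continuous_FTC2y _ _ F _ 0).
- by rewrite -EFinB sub0r /F mulNr opprK mulrC.
- by move=> x _; exact: powR_ge0.
- apply/continuous_within_itvcyP; split.
    move=> x; rewrite in_itv/= andbT => xa; apply: continuous_powR_at.
    exact: lt_trans xa.
  by apply: cvg_at_right_filter; exact: continuous_powR_at.
- rewrite /F -[X in _ --> X](mulr0 (- (2 * s)^-1)); apply: cvgMr.
  apply/cvgrPdist_le => e e0.
  have [X X0 hX] := @powR_neg_le_near_infty (2 * s) e (mulr_gt0 (ltr0Sn _ 1) s0) e0.
  near=> x; rewrite sub0r normrN ger0_norm ?powR_ge0//; apply: hX.
  by near: x; apply: nbhs_pinfty_ge; rewrite num_real.
- by move=> x ax; have [] := dF _ (lt_trans a0 ax).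
- apply: cvg_at_right_filter; apply: differentiable_continuous.
  by apply/derivable1_diffP; have [] := dF _ a0.
- move=> x; rewrite in_itv/= andbT => ax.
  by rewrite derive1E; have [_ ->] := dF _ (lt_trans a0 ax).
Unshelve. all: by end_near. Qed.

Lemma integralN_ge0 (D : set R) (f : R -> \bar R) : measurable D ->
  measurable_fun D f -> (forall t, D t -> (0 <= f t)%E) ->
  (\int[mu]_(t in -%R @^-1` D) f (- t)%R = \int[mu]_(t in D) f t)%E.
Proof.
move=> mD mf f0.
have mN : measurable_fun setT (-%R : measurableTypeR R -> measurableTypeR R).
  by [].
rewrite -(ge0_integral_pushforward mN lebesgue_measure mD mf); last first.
  by move=> t /set_mem; exact: f0.
by apply: eq_measure_integral => A mA _; exact: lebesgue_measureN.
Qed.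

Lemma integrableN (D : set R) (f : R -> \bar R) : measurable D ->
  -%R @^-1` D = D -> measurable_fun setT f -> mu.-integrable D f ->
  mu.-integrable D (fun t => f (- t)).
Proof.
move=> mD DN mf /integrableP[mDf fi]; apply/integrableP; split.
  by apply: measurable_funTS; exact: measurableT_comp.
rewrite -[X in integral _ X _]DN (@integralN_ge0 D (fun t => `|f t|%E))//.
exact: measurableT_comp.
Qed.

Lemma RintegralN (D : set R) H : measurable D -> -%R @^-1` D = D ->
  measurable_fun setT H -> mu.-integrable D (EFin \o H) ->
  \int[mu]_(t in D) H (- t) = \int[mu]_(t in D) H t.
Proof.
move=> mD DN mH iH; congr fine.
have mN : measurable_fun setT (-%R : measurableTypeR R -> measurableTypeR R).
  by [].
have mE : measurable_fun setT (EFin \o H) by exact/measurable_EFinP.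
transitivity (\int[pushforward mu
    (-%R : measurableTypeR R -> measurableTypeR R)]_(t in D)
    (EFin \o H) t)%E; last first.
  by apply: eq_measure_integral => A mA _; exact: lebesgue_measureN.
rewrite (integral_pushforward mN)//.
  by rewrite DN.
by rewrite DN; exact: integrableN.
Qed.

(** * Integrals against the kernel away from the origin *)

Definition tail_set a : set R := [set t | a <= `|t|].

Lemma tail_setE a : ~` `]- a, a[ = tail_set a.
Proof.
apply/seteqP; split=> t; rewrite /tail_set/= in_itv/= -ltr_norml.
  by move/negP; rewrite -leNgt.
by move=> at_; apply/negP; rewrite -leNgt.
Qed.

Definition tail_ind a (t : R) : R := ((a <= `|t|)%R : bool)%:R.

Lemma tail_setN a : -%R @^-1` tail_set a = tail_set a.
Proof. by apply/seteqP; split=> t; rewrite /tail_set/= normrN. Qed.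

Lemma measurable_tail_set a : measurable (tail_set a : set (measurableTypeR R)).
Proof. by rewrite -tail_setE; exact: measurableC. Qed.

Lemma integral_kern_tail s a : 0 < s -> 0 < a ->
  (\int[mu]_(t in tail_set a) (kern s t)%:E = (a `^ (- (2 * s)) / s)%:E)%E.
Proof.
move=> s0 a0.
have mk D : measurable_fun D (fun t => (kern s t)%:E).
  by apply/measurable_EFinP/measurable_funTS; exact: measurable_kern.
have -> : tail_set a = `[a, +oo[ `|` (-%R @^-1` `[a, +oo[).
  apply/seteqP; split=> t; rewrite /tail_set/= !in_itv/= !andbT.
    by rewrite ler_normr => /orP.
  by move=> h; rewrite ler_normr; apply/orP.
have mN : measurable (-%R @^-1` `[a, +oo[).
  have mN : measurable_fun setT (-%R : R -> measurableTypeR R) by [].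
  by rewrite -[X in measurable X]setTI; exact: mN.
rewrite ge0_integral_setU//=; last 3 first.
- exact: mk.
- by move=> t _; rewrite lee_fin kern_ge0.
- apply/disj_setPS => t [/=]; rewrite !in_itv/= !andbT => h1 h2.
  by lra.
have -> : (\int[mu]_(t in -%R @^-1` `[a, +oo[) (kern s t)%:E =
    \int[mu]_(t in `[a, +oo[) (kern s t)%:E)%E.
  rewrite -(@integralN_ge0 `[a, +oo[ (fun t => (kern s t)%:E))//; last first.
    by move=> t _; rewrite lee_fin kern_ge0.
  by congr (integral _ _ _); apply/funext => t; rewrite kernN.
rewrite !integral_kern_half// -EFinD; congr EFin.
have := gt_eqF s0; move=> /negbT s0'; field.
by rewrite s0'.
Qed.

Lemma integrable_bounded_kern_in s a c (D : set (measurableTypeR R)) F :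
  0 < s -> 0 < a -> measurable D -> D `<=` tail_set a ->
  measurable_fun setT F -> (forall t, D t -> `|F t| <= c) ->
  mu.-integrable D (EFin \o (fun t => F t * kern s t)).
Proof.
move=> s0 a0 mD Da mF Fc; have mT := measurable_tail_set a.
have ik : mu.-integrable (tail_set a) (EFin \o kern s).
  apply/integrableP; split.
    by apply/measurable_EFinP/measurable_funTS; exact: measurable_kern.
  under eq_integral do rewrite /= ger0_norm ?kern_ge0//.
  by rewrite integral_kern_tail// ltry.
have := integrableZl mD c (integrableS mT mD Da ik); apply: le_integrable => //.
- apply/measurable_EFinP/measurable_funTS/measurable_funM => //.
  exact: measurable_kern.
- move=> t Dt /=; rewrite lee_fin !normrM ler_wpM2r//.
  by rewrite (le_trans (Fc t Dt))// ler_norm.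
Qed.

Lemma integrable_bounded_kern s a c F : 0 < s -> 0 < a ->
  measurable_fun setT F -> (forall t, `|F t| <= c) ->
  mu.-integrable (tail_set a) (EFin \o (fun t => F t * kern s t)).
Proof.
move=> s0 a0 mF Fc.
apply: (@integrable_bounded_kern_in s a c (tail_set a)) => //.
exact: measurable_tail_set.
Qed.

Lemma Rintegral_kern_tail s a : 0 < s -> 0 < a ->
  \int[mu]_(t in tail_set a) kern s t = a `^ (- (2 * s)) / s.
Proof. by move=> s0 a0; rewrite /Rintegral integral_kern_tail. Qed.

Lemma tail_setI a b : a <= b -> tail_set a `&` tail_set b = tail_set b.
Proof.
move=> ab; apply/seteqP; split=> [t []//|t bt]; split=> //.
exact: le_trans ab bt.
Qed.

Lemma Rintegral_step_kern s a b : 0 < s -> 0 < a -> a <= b ->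
  \int[mu]_(t in tail_set a) (tail_ind b t * kern s t) = b `^ (- (2 * s)) / s.
Proof.
move=> s0 a0 ab; rewrite -(Rintegral_kern_tail s0 (lt_le_trans a0 ab)).
rewrite -(tail_setI ab) Rintegral_mkcondr; apply: eq_Rintegral => t _.
rewrite patchE; case: ifPn => [/set_mem|/negP h].
  by rewrite /tail_set /tail_ind/= => ->; rewrite mul1r.
rewrite /tail_ind; case: (boolP (b <= `|t|)) => [bt|]; last by rewrite mul0r.
by case: h; exact/mem_set.
Qed.

Lemma measurable_tail_ind a : measurable_fun setT (tail_ind a).
Proof.
rewrite (_ : tail_ind a = \1_(tail_set a)).
  by apply: measurable_indic; exact: measurable_tail_set.
apply/funext => t; rewrite /tail_ind indicE; congr (nat_of_bool _)%:R.
by apply/idP/idP => [h|/set_mem//]; exact/mem_set.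
Qed.

Lemma tail_ind_bounded a t : `|tail_ind a t| <= 1.
Proof. by rewrite /tail_ind normr_nat lern1 leq_b1. Qed.

(** The nonlocal term of [Ezd], kept as a [pv_int] to match that definition; [tail_intE] turns it
    into a plain integral when [F] is bounded and measurable. *)
Definition tail_int s d F : R := pv_int (~` `]- d, d[) (fun t => F t * kern s t).

(** For [e < d] the lower truncation is invisible, and the missing part, where |t| >= 1/e,
    contributes at most c e^(2s) / s, which tends to 0. *)
Lemma cvg_tail_int s d c F : 0 < s -> 0 < d -> measurable_fun setT F ->
  (forall t, `|F t| <= c) ->
  (\int[mu]_(t in (~` `]- d, d[) `&` [set t | e < `|t| < e^-1]) (F t * kern s t))
    @[e --> 0^'+] --> \int[mu]_(t in tail_set d) (F t * kern s t).
Proof.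
move=> s0 d0 mF Fc.
have c0 : 0 <= c by exact: le_trans (Fc 0).
have mT := measurable_tail_set.
have iF a : 0 < a -> mu.-integrable (tail_set a) (EFin \o (fun t => F t * kern s t)).
  by move=> a0; exact: integrable_bounded_kern Fc.
have key e : 0 < e -> e < d -> d <= e^-1 ->
  \int[mu]_(t in tail_set d) (F t * kern s t) -
  \int[mu]_(t in (~` `]- d, d[) `&` [set t | e < `|t| < e^-1]) (F t * kern s t) =
  \int[mu]_(t in tail_set e^-1) (F t * kern s t).
  move=> e0 ed de; rewrite tail_setE.
  have -> : tail_set d `&` [set t | e < `|t| < e^-1] =
      tail_set d `\` tail_set e^-1.
    apply/seteqP; split=> t; rewrite /tail_set/=.
      by move=> [dt /andP[_ te]]; split=> //; apply/negP; rewrite -ltNge.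
    move=> [dt /negP]; rewrite -ltNge => ->; split=> //.
    by rewrite andbT; exact: lt_le_trans dt.
  have TU : tail_set d = (tail_set d `\` tail_set e^-1) `|` tail_set e^-1.
    by rewrite setUC setDUK// => t; exact: le_trans.
  rewrite [in X in X - _]TU Rintegral_setU//.
  - by rewrite addrC addKr.
  - exact: measurableD.
  - by rewrite -TU; exact: iF.
  - by apply/disj_setPS => t [[_ h]] /h.
apply/cvgrPdist_le => eps eps0.
(* Gives [c * (q / s) <= eps]; the [+ 1] covers [c = 0]. *)
pose q := eps * s / (c + 1).
have q0 : 0 < q by rewrite divr_gt0 ?mulr_gt0// ltr_wpDl.
have [X X0 hX] := @powR_neg_le_near_infty (2 * s) q (mulr_gt0 (ltr0Sn _ 1) s0) q0.
near=> e.
have e0 : 0 < e by near: e; exact: nbhs_right_gt.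
have ed : e < d by near: e; exact: nbhs_right_lt.
have de : d <= e^-1.
  rewrite -[leLHS]invrK lef_pV2 ?posrE ?invr_gt0//.
  by near: e; apply: nbhs_right_le; rewrite invr_gt0.
have Xe : X <= e^-1.
  rewrite -[leLHS]invrK lef_pV2 ?posrE ?invr_gt0//.
  by near: e; apply: nbhs_right_le; rewrite invr_gt0.
have ei : 0 < e^-1 by rewrite invr_gt0.
rewrite key//; apply: le_trans (le_normr_Rintegral (mT _) (iF _ ei)) _.
have ik b : 0 < b -> mu.-integrable (tail_set b) (EFin \o (fun t => 1 * kern s t)).
  by move=> b0; apply: (@integrable_bounded_kern _ _ 1 (fun=> 1)) => // t; rewrite normr1.
apply: (@le_trans _ _ (\int[mu]_(t in tail_set e^-1) (c * (1 * kern s t)))).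
  apply: le_Rintegral => //.
  - exact: (integrable_norm (iF _ ei)).
  - exact: (integrableZl (mT _) c (ik _ ei)).
  - move=> t _; rewrite normrM mul1r (ger0_norm (kern_ge0 _ _)).
    by rewrite ler_wpM2r// kern_ge0.
rewrite RintegralZl//; last exact: ik.
under eq_Rintegral do rewrite mul1r.
rewrite Rintegral_kern_tail//.
apply: (@le_trans _ _ (c * (q / s))).
  by rewrite ler_wpM2l// ler_pM2r ?invr_gt0// hX.
rewrite /q mulrAC -[eps * s / s]mulrA mulfV ?gt_eqF// mulr1 mulrCA ger_pMr//.
by rewrite ler_pdivrMr ?mul1r ?lerDl// ltr_wpDl.
Unshelve. all: by end_near. Qed.

Lemma tail_intE s d c F : 0 < s -> 0 < d -> measurable_fun setT F ->
  (forall t, `|F t| <= c) ->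
  tail_int s d F = \int[mu]_(t in tail_set d) (F t * kern s t).
Proof. by move=> s0 d0 mF Fc; apply/cvg_lim => //; exact: cvg_tail_int Fc. Qed.

Lemma tail_intN s d c F : 0 < s -> 0 < d -> measurable_fun setT F ->
  (forall t, `|F t| <= c) -> tail_int s d (fun t => - F t) = - tail_int s d F.
Proof.
move=> s0 d0 mF Fc; rewrite (tail_intE s0 d0 mF Fc) (@tail_intE _ _ c)//.
- rewrite -mulN1r -RintegralZl//.
  + by apply: eq_Rintegral => t _; rewrite mulN1r mulNr.
  + exact: measurable_tail_set.
  + exact: integrable_bounded_kern Fc.
- exact: measurableT_comp.
- by move=> t; rewrite normrN.
Qed.

Lemma tail_intB s d c F H : 0 < s -> 0 < d ->
  measurable_fun setT F -> (forall t, `|F t| <= c) ->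
  measurable_fun setT H -> (forall t, `|H t| <= c) ->
  tail_int s d (fun t => F t - H t) = tail_int s d F - tail_int s d H.
Proof.
move=> s0 d0 mF Fc mH Hc.
rewrite (tail_intE s0 d0 mF Fc) (tail_intE s0 d0 mH Hc) (@tail_intE _ _ (c + c))//.
- rewrite -RintegralB//.
  + by apply: eq_Rintegral => t _; rewrite mulrBl.
  + exact: measurable_tail_set.
  + exact: integrable_bounded_kern Fc.
  + exact: integrable_bounded_kern Hc.
- exact: measurable_funB.
- by move=> t; rewrite (le_trans (ler_normB _ _))// lerD.
Qed.

(* Only the even part of the integrand matters, as [tail_set d] is symmetric. *)
Lemma tail_int_le s d c F (x1 x2 x3 a1 a2 a3 : R) : 0 < s -> 0 < d ->
  measurable_fun setT F -> (forall t, `|F t| <= c) ->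
  d <= a1 -> d <= a2 -> d <= a3 ->
  (forall t, d <= t -> F t + F (- t) <=
    x1 * tail_ind a1 t + x2 * tail_ind a2 t + x3 * tail_ind a3 t) ->
  tail_int s d F <= (x1 * a1 `^ (- (2 * s)) + x2 * a2 `^ (- (2 * s))
    + x3 * a3 `^ (- (2 * s))) / (2 * s).
Proof.
move=> s0 d0 mF Fc da1 da2 da3 hS; rewrite (tail_intE s0 d0 mF Fc).
have mT := measurable_tail_set d.
pose G t := F t * kern s t.
have iG : mu.-integrable (tail_set d) (EFin \o G) by exact: integrable_bounded_kern Fc.
have mG : measurable_fun setT G by apply: measurable_funM => //; exact: measurable_kern.
have iGN : mu.-integrable (tail_set d) (EFin \o (fun t => G (- t))).
  apply: (@integrableN _ (EFin \o G)) => //; first exact: tail_setN.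
  exact/measurable_EFinP.
pose K a t := tail_ind a t * kern s t.
have iK a : mu.-integrable (tail_set d) (EFin \o K a).
  apply: (@integrable_bounded_kern _ _ 1) => //; first exact: measurable_tail_ind.
  exact: tail_ind_bounded.
have iZ x a : mu.-integrable (tail_set d) (EFin \o (fun t => x * K a t)).
  exact: (integrableZl mT x (iK a)).
have iD (f g : R -> R) : mu.-integrable (tail_set d) (EFin \o f) ->
    mu.-integrable (tail_set d) (EFin \o g) ->
    mu.-integrable (tail_set d) (EFin \o (fun t => f t + g t)).
  by move=> hf hg; exact: (integrableD mT hf hg).
have : \int[mu]_(t in tail_set d) (G t + G (- t)) <=
    \int[mu]_(t in tail_set d) (x1 * K a1 t + x2 * K a2 t + x3 * K a3 t).
  apply: le_Rintegral => //; [exact: iD|by apply: (iD) => //; exact: iD|].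
  move=> t dt; rewrite /G /K kernN -mulrDl !mulrA -!mulrDl.
  apply: ler_wpM2r; first exact: kern_ge0.
  have [t0|t0] := leP 0 t.
    by apply: hS; move: dt; rewrite /tail_set/= ger0_norm.
  have := hS (- t); rewrite opprK addrC /tail_ind normrN; apply.
  by move: dt; rewrite /tail_set/= ltr0_norm.
rewrite RintegralD// (RintegralN mT (tail_setN d) mG iG).
rewrite (RintegralD mT) ?(RintegralD mT)//; last exact: iD.
rewrite !RintegralZl// !Rintegral_step_kern// => h.
set L := \int[mu]_(t in _) _ in h *.
rewrite ler_pdivlMr ?mulr_gt0//.
move: h; rewrite !mulrA -!mulrDl ler_pdivlMr// => h.
by apply: le_trans h; lra.
Qed.

(** * Singular part of the operator on quadratic test functions *)

Lemma integral_sqr_kern_half s e d : s < 1 -> 0 < e -> e < d ->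
  (\int[mu]_(t in `]e, d]) (t ^+ 2 * kern s t)%:E =
   ((d `^ (2 - 2 * s) - e `^ (2 - 2 * s)) / (2 - 2 * s))%:E)%E.
Proof.
move=> s1 e0 ed; have s20 : 2 - 2 * s != 0 by rewrite gt_eqF//; lra.
pose F t := (2 - 2 * s)^-1 * t `^ (2 - 2 * s).
pose h (t : R) := t `^ (1 - 2 * s).
have dF t : 0 < t -> is_derive t 1 F (h t).
  move=> t0; have := is_derive1_powR (2 - 2 * s) t0 => dp.
  rewrite /F; apply: is_derive_eq.
  rewrite /GRing.scale/= mulrA mulVf// mul1r; congr powR; ring.
have ch t : 0 < t -> {for t, continuous h} by exact: continuous_powR_at.
have cF t : 0 < t -> {for t, continuous F}.
  move=> t0; apply: differentiable_continuous.
  by apply/derivable1_diffP; have [] := dF _ t0.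
have d0 := lt_trans e0 ed.
transitivity (\int[mu]_(t in `]e, d]) (h t)%:E)%E.
  apply: eq_integral => t; rewrite inE/= in_itv/= => /andP[et _].
  have t0 := lt_trans e0 et.
  rewrite kernE// -powR_mulrn ?(ltW t0)// -powRD.
    by congr (powR _ _)%:E; ring.
  by apply/implyP => _; rewrite gt_eqF.
rewrite integral_itv_obnd_cbnd; last first.
  apply/measurable_EFinP/measurable_funTS; exact: measurable_powR.
rewrite (@continuous_FTC2 _ h F)//.
- by rewrite -EFinB /F -mulrBr mulrC.
- apply: continuous_in_subspaceT => t; rewrite inE/= in_itv/= => /andP[et _].
  by apply: ch; exact: lt_le_trans et.
- split.
  + move=> t; rewrite in_itv/= => /andP[et _].
    by have [] := dF _ (lt_trans e0 et).
  + by apply: cvg_at_right_filter; exact: cF.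
  + by apply: cvg_at_left_filter; exact: cF.
- move=> t; rewrite in_itv/= => /andP[et _].
  by rewrite derive1E; have [_ ->] := dF _ (lt_trans e0 et).
Qed.

(** The annulus is symmetric, so averaging with the reflected integrand removes the odd term
    [be * t]. *)
Lemma Rintegral_quad_kern s e d (al be : R) : 0 < s < 1 -> 0 < e -> e < d ->
  \int[mu]_(t in [set t | e < `|t| <= d]) ((be * t + al * t ^+ 2) * kern s t) =
  al * ((d `^ (2 - 2 * s) - e `^ (2 - 2 * s)) / (1 - s)).
Proof.
move=> /andP[s0 s1] e0 ed; have d0 := lt_trans e0 ed.
pose D : set R := [set t | e < `|t| <= d].
have DE : D = `]e, d] `|` (-%R @^-1` `]e, d]).
  apply/seteqP; split=> t; rewrite /D/= !in_itv/=.
    by have [t0|t0] := leP 0 t; [rewrite ger0_norm//; left|rewrite ltr0_norm//; right].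
  by move=> [] /andP[h1 h2]; [rewrite gtr0_norm|rewrite ltr0_norm]; lra.
have mN : measurable (-%R @^-1` `]e, d] : set (measurableTypeR R)).
  have mN : measurable_fun setT (-%R : measurableTypeR R -> measurableTypeR R).
    by [].
  by rewrite -[X in measurable X]setTI; exact: mN.
have mD : measurable (D : set (measurableTypeR R)).
  by rewrite DE; exact: measurableU.
have DN : -%R @^-1` D = D.
  by apply/seteqP; split=> t; rewrite /D/= normrN.
have msq : measurable_fun setT (fun t : R => t ^+ 2) by exact: exprn_measurable.
have mk := @measurable_kern s.
have msk : measurable_fun setT (fun t : R => (t ^+ 2 * kern s t)%:E).
  by apply/measurable_EFinP; exact: measurable_funM.
have sk0 t : (0%:E <= (t ^+ 2 * kern s t)%:E)%E.
  by rewrite lee_fin mulr_ge0 ?sqr_ge0 ?kern_ge0.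
have Isq : \int[mu]_(t in D) (t ^+ 2 * kern s t) =
    (d `^ (2 - 2 * s) - e `^ (2 - 2 * s)) / (1 - s).
  rewrite /Rintegral DE ge0_integral_setU//=; last 2 first.
  - exact: measurable_funTS.
  - by apply/disj_setPS => t [/=]; rewrite !in_itv/=; lra.
  have -> : (\int[mu]_(t in -%R @^-1` `]e, d]) (t ^+ 2 * kern s t)%:E =
      \int[mu]_(t in `]e, d]) (t ^+ 2 * kern s t)%:E)%E.
    rewrite -(@integralN_ge0 `]e, d] (fun t => (t ^+ 2 * kern s t)%:E))//; last first.
      exact: measurable_funTS.
    by congr (integral _ _ _); apply/funext => t; rewrite kernN sqrrN.
  rewrite !integral_sqr_kern_half//=.
  by field; apply/andP; split; rewrite gt_eqF//; lra.
pose H t := (be * t + al * t ^+ 2) * kern s t.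
have mq : measurable_fun setT (fun t : R => be * t + al * t ^+ 2).
  by apply: measurable_funD; apply: measurable_funM.
have mH : measurable_fun setT H by exact: measurable_funM.
have De : D `<=` tail_set e by move=> t /andP[/ltW].
have iH : mu.-integrable D (EFin \o H).
  apply: (@integrable_bounded_kern_in s e (`|be| * d + `|al| * d ^+ 2)) => //.
  move=> t /andP[_ td]; rewrite (le_trans (ler_normD _ _))// !normrM.
  rewrite lerD// ler_wpM2l//.
  by rewrite -expr2; apply: lerXn2r => //; rewrite nnegrE// ltW.
have isq : mu.-integrable D (EFin \o (fun t => t ^+ 2 * kern s t)).
  apply: (@integrable_bounded_kern_in s e (d ^+ 2)) => //.
  move=> t /andP[_ td]; rewrite normrX.
  by apply: lerXn2r => //; rewrite nnegrE// ltW.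
have iHN : mu.-integrable D (EFin \o (fun t => H (- t))).
  by apply: (@integrableN _ (EFin \o H)) => //; exact/measurable_EFinP.
have : \int[mu]_(t in D) (H t + H (- t)) = 2 * al * \int[mu]_(t in D) (t ^+ 2 * kern s t).
  rewrite -RintegralZl//; apply: eq_Rintegral => t _.
  by rewrite /H kernN; ring.
rewrite RintegralD// (RintegralN mD DN mH iH) Isq => h.
have -> : \int[mu]_(t in D) H t = (\int[mu]_(t in D) H t + \int[mu]_(t in D) H t) / 2.
  by field.
by rewrite h; field; rewrite gt_eqF//; lra.
Qed.

(** Since [s < 1], the term e^(2-2s) of the annulus formula vanishes in the limit. The result
    ignores [be] and tends to 0 with [d], so a small [d] absorbs a large [al]. *)
Lemma pv_int_quad s d (al be : R) (G : R -> R) : 0 < s < 1 -> 0 < d ->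
  (forall t, G t = be * t + al * t ^+ 2) ->
  pv_int `[- d, d] (fun t => G t * kern s t) = al * (d `^ (2 - 2 * s) / (1 - s)).
Proof.
move=> s01 d0 /funext ->; have /andP[s0 s1] := s01.
apply/cvg_lim => //.
apply: (@cvg_trans _ ((fun e => al * ((d `^ (2 - 2 * s) - e `^ (2 - 2 * s)) / (1 - s)))
    @ (0 : R)^'+)).
  apply: near_eq_cvg; near=> e.
  have e0 : 0 < e by near: e; exact: nbhs_right_gt.
  have ed : e < d by near: e; exact: nbhs_right_lt.
  have de : d < e^-1.
    rewrite -[ltLHS]invrK ltf_pV2 ?posrE ?invr_gt0//.
    by near: e; apply: nbhs_right_lt; rewrite invr_gt0.
  rewrite -(Rintegral_quad_kern al be s01 e0 ed); congr Rintegral.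
  apply/seteqP; split=> t /=; rewrite in_itv/= -ler_norml.
    by move=> /andP[-> td]; rewrite td (le_lt_trans td).
  by move=> [-> /andP[->]].
rewrite -[X in al * (X / _)](subr0 (d `^ _)).
apply: cvgMr; apply: cvgMl; apply: cvgB; first exact: cvg_cst.
by apply: powR_cvg0; lra.
Unshelve. all: by end_near. Qed.

(** Paired increments gain [c / 4] between [2 * P] and [L * P] and lose at most [4 * M] beyond.
    Every term scales like P^(-2s), and the condition on [L] says that the far correction uses up at
    most half of the gain. *)
Lemma tail_int_two_steps_ge s d F (M c L P : R) : 0 < s -> 0 < d ->
  measurable_fun setT F -> (forall t, `|F t| <= 2 * M) ->
  2 <= L -> d <= P ->
  (4 * M + c / 4) * L `^ (- (2 * s)) <= c / 8 * 2 `^ (- (2 * s)) ->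
  (forall t, 0 <= t -> t < L * P -> 0 <= F t + F (- t)) ->
  (forall t, 2 * P <= t -> t < L * P -> c / 4 <= F t + F (- t)) ->
  c / 8 * 2 `^ (- (2 * s)) / (2 * s) * P `^ (- (2 * s)) <= tail_int s d F.
Proof.
move=> s0 d0 mF Fb L2 dP hL S0 S1.
have P0 : 0 < P by exact: lt_le_trans dP.
have LP2 : 2 * P <= L * P by rewrite ler_pM2r.
have d2P : d <= 2 * P by lra.
have mNF : measurable_fun setT (fun t => - F t) by exact: measurableT_comp.
have NFb t : `|- F t| <= 2 * M by rewrite normrN.
(* Steps for [- F]: height [- (c / 4)] from [2 * P] on, then a jump of [4 * M + c / 4] at [L * P];
   the third step is void. *)
have hI : - tail_int s d F <= (- (c / 4) * (2 * P) `^ (- (2 * s)) +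
    (4 * M + c / 4) * (L * P) `^ (- (2 * s)) + 0 * d `^ (- (2 * s))) / (2 * s).
  rewrite -(tail_intN s0 d0 mF Fb).
  apply: (tail_int_le s0 d0 mNF NFb d2P (le_trans d2P LP2) (lexx d)) => t dt.
  have t0 : 0 <= t by rewrite (le_trans (ltW d0)).
  rewrite /tail_ind ger0_norm// mul0r addr0 -opprD.
  have [t1|t1] := ltP t (2 * P).
    have tLP : t < L * P by exact: lt_le_trans LP2.
    by rewrite (leNgt (L * P)) tLP/= !mulr0 addr0 oppr_le0; exact: S0.
  have [tLP|tLP] := ltP t (L * P).
    by rewrite /= mulr0 mulr1 addr0 lerN2; exact: S1.
  rewrite /= !mulr1; have := Fb t; have := Fb (- t); rewrite !ler_norml.
  by move=> /andP[h1 _] /andP[h2 _]; clear - h1 h2; lra.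
rewrite mul0r addr0 !powRM ?(ltW P0)// in hI; last by lra.
rewrite -lerN2; apply: le_trans hI _; have tP0 := powR_ge0 P (- (2 * s)).
move: hL tP0; move: (2 `^ _) (L `^ _) (P `^ _) => t2 tL tP hL tP0.
have -> : - (c / 8 * t2 / (2 * s) * tP) = - (c / 8 * t2) * tP / (2 * s) by ring.
rewrite ler_pM2r ?invr_gt0 ?mulr_gt0// !mulrA -mulrDl ler_wpM2r//.
by clear - hL; lra.
Qed.

End Kernel.

(** * Euclidean geometry of row vectors and quadratic test functions *)

Section Euclid.
Variables (R : realType) (N : nat).
Notation V := 'rV[R]_N.
Implicit Types (x y z k : V) (r e t al c : R).

Definition dot x y : R := \sum_(i < N) x 0 i * y 0 i.

Lemma dotC x y : dot x y = dot y x.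
Proof. by apply: eq_bigr => i _; rewrite mulrC. Qed.

Lemma dotDl x y z : dot (x + y) z = dot x z + dot y z.
Proof. by rewrite -big_split; apply: eq_bigr => i _ /=; rewrite mxE mulrDl. Qed.

Lemma dotZl t x y : dot (t *: x) y = t * dot x y.
Proof. by rewrite big_distrr; apply: eq_bigr => i _ /=; rewrite mxE mulrA. Qed.

Lemma dotNl x y : dot (- x) y = - dot x y.
Proof. by rewrite -scaleN1r dotZl mulN1r. Qed.

Lemma dotDr x y z : dot x (y + z) = dot x y + dot x z.
Proof. by rewrite dotC dotDl !(dotC _ x). Qed.

Lemma dotZr t x y : dot x (t *: y) = t * dot x y.
Proof. by rewrite dotC dotZl dotC. Qed.

Lemma dotNr x y : dot x (- y) = - dot x y.
Proof. by rewrite dotC dotNl dotC. Qed.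

Definition dotE := (dotDl, dotDr, dotZl, dotZr, dotNl, dotNr).

Lemma dot0l y : dot 0 y = 0.
Proof. by rewrite -(scale0r y) dotZl mul0r. Qed.

Lemma dot_ge0 x : 0 <= dot x x.
Proof. by apply: sumr_ge0 => i _; rewrite -expr2 sqr_ge0. Qed.

Lemma dot_sqr_DZ x y t :
  dot (x + t *: y) (x + t *: y) = dot x x + 2 * t * dot x y + t ^+ 2 * dot y y.
Proof. by rewrite !dotE (dotC y x); ring. Qed.

Lemma enormE x : enorm x = Num.sqrt (dot x x).
Proof. by congr Num.sqrt; apply: eq_bigr => i _; rewrite expr2. Qed.

Lemma enorm_ge0 x : 0 <= enorm x.
Proof. by rewrite sqrtr_ge0. Qed.

Lemma enorm_sqr x : enorm x ^+ 2 = dot x x.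
Proof. by rewrite enormE sqr_sqrtr// dot_ge0. Qed.

Lemma enorm0 : enorm (0 : V) = 0.
Proof. by rewrite enormE dot0l sqrtr0. Qed.

Lemma enormN x : enorm (- x) = enorm x.
Proof. by rewrite !enormE dotNl dotNr opprK. Qed.

Lemma enormBC x y : enorm (x - y) = enorm (y - x).
Proof. by rewrite -enormN opprB. Qed.

Lemma enormZ t x : enorm (t *: x) = `|t| * enorm x.
Proof.
by rewrite !enormE dotZl dotZr mulrA -expr2 sqrtrM ?sqr_ge0// sqrtr_sqr.
Qed.

Lemma coord_le_enorm x i : `|x 0 i| <= enorm x.
Proof.
rewrite -(@ler_pXn2r _ 2) ?nnegrE ?normr_ge0 ?enorm_ge0//.
rewrite -normrX ger0_norm ?sqr_ge0// enorm_sqr /dot (bigD1 i)//= -expr2.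
by rewrite lerDl sumr_ge0// => j _; rewrite -expr2 sqr_ge0.
Qed.

Lemma enorm_eq0 x : enorm x = 0 -> x = 0.
Proof.
move=> x0; apply/rowP => i; rewrite mxE; apply/eqP.
by rewrite -normr_le0 -x0 coord_le_enorm.
Qed.

Lemma dot_le x y : dot x y <= enorm x * enorm y.
Proof.
have [x0|x0] := eqVneq (enorm x) 0.
  by rewrite (enorm_eq0 x0) dot0l enorm0 mul0r.
have [y0|y0] := eqVneq (enorm y) 0.
  by rewrite (enorm_eq0 y0) dotC dot0l enorm0 mulr0.
have px : 0 < enorm x by rewrite lt_neqAle eq_sym x0 enorm_ge0.
have py : 0 < enorm y by rewrite lt_neqAle eq_sym y0 enorm_ge0.
have := dot_ge0 (enorm y *: x - enorm x *: y).
rewrite !dotE -!enorm_sqr (dotC y x) => h.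
have {}h : 0 <= 2 * (enorm x * enorm y) * (enorm x * enorm y - dot x y).
  by apply: le_trans h _; rewrite le_eqVlt; apply/orP; left; apply/eqP; ring.
rewrite -subr_ge0; move: h; rewrite pmulr_rge0//.
by rewrite !mulr_gt0.
Qed.

Lemma enormD x y : enorm (x + y) <= enorm x + enorm y.
Proof.
rewrite -(@ler_pXn2r _ 2) ?nnegrE ?addr_ge0 ?enorm_ge0//.
rewrite enorm_sqr !dotE -!enorm_sqr (dotC y x).
by have := dot_le x y; rewrite sqrrD -mulr_natr; lra.
Qed.

Lemma enorm_triangle y x z : enorm (x - z) <= enorm (x - y) + enorm (y - z).
Proof. by rewrite -[x - z](subrKA y) enormD. Qed.

Lemma normr_dot_le x y : `|dot x y| <= enorm x * enorm y.
Proof.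
by rewrite ler_norml dot_le andbT lerNl -dotNl -(enormN x) dot_le.
Qed.

Lemma near_eball x r : 0 < r -> \forall y \near x, eball x r y.
Proof.
(* The topology of row vectors is that of the sup norm, and [enorm] is at most [N] times it; the
   [+ 1] makes the final bound strict and covers [N = 0]. *)
move=> r0; pose q := r / (N%:R + 1).
have n1 : 0 < N%:R + 1 :> R by rewrite ltr_wpDl.
have q0 : 0 < q by rewrite divr_gt0.
apply/nbhs_ballP; exists q => //= y; rewrite -ball_normE/= => xyq.
rewrite /eball/= enormBC.
have h i : `|(x - y) 0 i| <= q.
  apply: le_trans (ltW xyq); rewrite [leRHS]/Num.Def.normr/= mx_normrE.
  by apply: (le_bigmax _ (fun ij : 'I_1 * 'I_N => `|(x - y) ij.1 ij.2|) (0, i)).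
apply: (@le_lt_trans _ _ (N%:R * q)).
  rewrite -(@ler_pXn2r _ 2) ?nnegrE ?mulr_ge0 ?enorm_ge0 ?(ltW q0) ?(ltW r0)//.
  rewrite enorm_sqr; apply: (@le_trans _ _ (\sum_(i < N) q ^+ 2)).
    apply: ler_sum => i _; rewrite -expr2 -[leLHS]ger0_norm ?sqr_ge0// normrX.
    by rewrite ler_pXn2r ?nnegrE ?(ltW q0).
  rewrite sumr_const card_ord -[q ^+ 2 *+ N]mulr_natl [leRHS]exprMn ler_wpM2r ?sqr_ge0//.
  by rewrite -natrX ler_nat; case: N => // n; rewrite leq_pmulr.
by rewrite /q mulrCA gtr_pMr// ltr_pdivrMr// mul1r ltrDl.
Qed.

Lemma nearP_eball x (P : set V) :
  (\forall y \near x, P y) <-> exists2 r, 0 < r & forall y, eball x r y -> P y.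
Proof.
split=> [/nbhs_ballP[r /= r0 rP]|[r r0 rP]]; last first.
  by apply: filterS (near_eball x r0).
exists r => // y xyr; apply: rP; rewrite -ball_normE/=.
rewrite [ltLHS]/Num.Def.normr/= mx_normrE; apply/bigmax_ltP; split=> // -[j i] _ /=.
rewrite ord1; apply: le_lt_trans (coord_le_enorm _ _) _.
by rewrite enormBC.
Qed.

Lemma lipschitz_continuous (h : V -> R) c :
  (forall x y, `|h x - h y| <= c * enorm (x - y)) -> continuous h.
Proof.
move=> hc x; apply/(@cvgrPdist_lt _ _ _ (nbhs x)) => e e0.
have c0 : 0 < `|c| + 1 by rewrite ltr_wpDl.
apply/nearP_eball; exists (e / (`|c| + 1)) => [|y]; first exact: divr_gt0.
rewrite /eball/= enormBC ltr_pdivlMr// mulrC; apply: le_lt_trans.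
apply: le_trans (hc x y) _; rewrite ler_wpM2r ?enorm_ge0//.
by rewrite (le_trans (ler_norm _))// lerDl.
Qed.

Lemma continuous_enormB y : continuous (fun x => enorm (x - y)).
Proof.
apply: (@lipschitz_continuous _ 1) => x z; rewrite mul1r ler_norml.
have := enorm_triangle z x y; have := enorm_triangle x z y.
by rewrite (enormBC z x) => h1 h2; apply/andP; split; lra.
Qed.

Lemma continuous_dot k : continuous (dot k).
Proof.
apply: (@lipschitz_continuous _ (enorm k)) => x z.
by rewrite -dotNr -dotDr normr_dot_le.
Qed.

Lemma continuous_line x z : continuous (fun t : R => x + t *: z).
Proof.
move=> t; apply: cvgD; first exact: cvg_cst.
by apply: cvgZ; [exact: cvg_id|exact: cvg_cst].
Qed.

Lemma compact_ebounded (A : set V) : closed A -> ebounded A -> compact A.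
Proof.
move=> cA [M AM]; apply: bounded_closed_compact => //.
exists M; split; first exact: num_real.
move=> q Mq x Ax /=; rewrite [leLHS]/Num.Def.normr/= mx_normrE; apply/bigmax_leP.
have xM := AM _ Ax; split.
  by rewrite (le_trans (enorm_ge0 x))// (le_trans xM)// ltW.
move=> [j i] _ /=; rewrite ord1; apply: le_trans (coord_le_enorm _ _) _.
by rewrite (le_trans xM)// ltW.
Qed.

(** All test functions below have this form. The family is closed under directional derivatives,
    which gives [C2], and along every unit direction the leading coefficient is the same [al]. *)
Definition quad al k c y : R := al * dot y y + dot k y + c.

Lemma continuous_quad al k c : continuous (quad al k c).
Proof.
have -> : quad al k c = (fun y => al * (enorm (y - 0) * enorm (y - 0)) + dot k y + c).
  by apply/funext => y; rewrite /quad subr0 -expr2 enorm_sqr.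
move=> x; apply: (@cvgD _ _ _ (nbhs x)); last exact: cvg_cst.
apply: (@cvgD _ _ _ (nbhs x)); last exact: continuous_dot.
apply: (@cvgM _ _ (nbhs x)); first exact: cvg_cst.
by apply: (@cvgM _ _ (nbhs x)); exact: continuous_enormB.
Qed.

Lemma is_derive_quad al k c x v :
  is_derive x v (quad al k c) (quad 0 ((2 * al) *: v) (dot k v) x).
Proof.
have h : h^-1 *: ((quad al k c \o shift x) (h *: v) - quad al k c x)
    @[h --> (0 : R)^'] --> quad 0 ((2 * al) *: v) (dot k v) x.
  apply: (@cvg_trans _ (((fun h : R => quad 0 ((2 * al) *: v) (dot k v) x
      + h * (al * dot v v)) @ (0 : R)^'))).
    apply: near_eq_cvg; near=> h.
    have h0 : h != 0 by near: h; exact: nbhs_dnbhs_neq.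
    rewrite /quad /= !dotE (dotC x v) /GRing.scale/=.
    by field.
  suff : quad 0 ((2 * al) *: v) (dot k v) x + h * (al * dot v v) @[h --> (0 : R)^'] -->
      quad 0 ((2 * al) *: v) (dot k v) x + 0 * (al * dot v v).
    by rewrite mul0r addr0.
  apply: cvgD; first exact: cvg_cst.
  by apply: cvgMl; exact: cvg_within.
by split; [apply/cvg_ex; eexists; exact: h|exact/cvg_lim].
Unshelve. all: by end_near. Qed.

Lemma C2_quad al k c : C2 (quad al k c).
Proof.
have der al' k' c' x v : derivable (quad al' k' c') x v.
  by have [] := is_derive_quad al' k' c' x v.
have D1 al' k' c' v : (fun x => 'D_v (quad al' k' c') x) =
    quad 0 ((2 * al') *: v) (dot k' v).
  by apply/funext => x; have [_ ->] := is_derive_quad al' k' c' x v.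
split; first exact: continuous_quad.
split; first by move=> i x; exact: der.
split; first by move=> i; rewrite D1; exact: continuous_quad.
split=> [i j x|i j]; rewrite D1; first exact: der.
by rewrite D1; exact: continuous_quad.
Qed.

Lemma quad_line al k c x z t : enorm z = 1 ->
  quad al k c (x + t *: z) - quad al k c x =
  (2 * al * dot x z + dot k z) * t + al * t ^+ 2.
Proof.
move=> z1; have zz : dot z z = 1 by rewrite -enorm_sqr z1 expr1n.
by rewrite /quad !dotE zz (dotC z x); ring.
Qed.

Lemma sphere_neq0 : (0 < N)%N -> @sphere R N !=set0.
Proof.
move=> N0; pose i := Ordinal N0; exists (evec R i).
rewrite /sphere/= enormE /dot (bigD1 i)//= !mxE eqxx mulr1 big1 ?addr0 ?sqrtr1//.
by move=> j ji; rewrite !mxE eq_sym (negbTE ji) mul0r.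
Qed.

End Euclid.

(** * Lower semicontinuity and compactness *)

Section Lsc.
Variable R : realType.

(** Stated over any topological space because it is applied on the space of rows and on its square.
    Subsolutions are handled through it too, written as [- a] with [a] lower semicontinuous. *)
Definition lsc (T : topologicalType) (b : T -> R) :=
  forall x a, a < b x -> \forall y \near x, a < b y.

Lemma lscD (T : topologicalType) (b h : T -> R) :
  lsc b -> lsc h -> lsc (fun x => b x + h x).
Proof.
move=> lb lh x a abh; pose e := (b x + h x - a) / 2.
have e0 : 0 < e by rewrite divr_gt0// subr_gt0.
have /lb B : b x - e < b x by rewrite ltrBlDr ltrDl.
have /lh H : h x - e < h x by rewrite ltrBlDr ltrDl.
by apply: filterS2 B H => y h1 h2; rewrite /e in h1 h2; lra.
Qed.

Lemma continuous_lsc (T : topologicalType) (h : T -> R) : continuous h -> lsc h.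
Proof. by move=> ch x a ahx; exact: (cvgr_gt _ (ch x)). Qed.

Lemma lsc_comp (S T : topologicalType) (h : S -> T) (b : T -> R) :
  continuous h -> lsc b -> lsc (b \o h).
Proof. by move=> ch lb x a /lb; exact: ch. Qed.

(** If the infimum is not attained, every point of [K] has a neighbourhood on which [b] exceeds some
    level above the infimum; by compactness one such level serves all of [K], which is absurd. *)
Lemma compact_lsc_min (T : topologicalType) (K : set T) (b : T -> R) (m : R) :
  compact K -> K !=set0 -> lsc b -> (forall x, K x -> m <= b x) ->
  exists2 x, K x & forall y, K y -> b x <= b y.
Proof.
move=> cK [x0 Kx0] lb bm; pose E := b @` K.
have E0 : E !=set0 by exists (b x0), x0.
have lE : has_lbound E by exists m => _ [x Kx <-]; exact: bm.
have [//|noinf] := pselect (exists2 x, K x & forall y, K y -> b x <= b y).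
have gti x : K x -> inf E < b x.
  move=> Kx; rewrite lt_neqAle; apply/andP; split; last first.
    by apply: ge_inf => //; exists x.
  apply/eqP => infx; apply: noinf; exists x => // y Ky.
  by rewrite -infx; apply: ge_inf => //; exists y.
have : \forall i \near (inf E)^'+, forall x, K x -> i < b x.
  apply: (compact_near_coveringP K).1 => // x Kx.
  have := gti _ Kx; pose a := (inf E + b x) / 2 => ibx.
  have ab : a < b x by rewrite /a; lra.
  have ia : inf E < a by rewrite /a; lra.
  exists ([set y | a < b y], [set i | i < a]) => /=.
    by split; [exact: lb|exact: nbhs_right_lt].
  by move=> [y i] /= [ay ia']; exact: lt_trans ay.
move=> near_i; near (inf E)^'+ => i.
have iK : forall x, K x -> i < b x by near: i.
have : i <= inf E by apply: lb_le_inf => // _ [x Kx <-]; exact/ltW/iK.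
by rewrite leNgt => /negP; case; near: i; exact: nbhs_right_gt.
Unshelve. all: by end_near. Qed.

Variable N : nat.
Notation V := 'rV[R]_N.
Implicit Types (x y z : V) (b g : V -> R).

(** Compactness makes the radius uniform in [w]. The points [x] and [y] may differ and may lie
    outside [K]: this carries bounds on the diagonal over to doubled variables. *)
Lemma compact_lsc_diag (K : set V) (b1 b2 : V -> R) (m eta : R) :
  compact K -> lsc b1 -> lsc b2 -> (forall x, K x -> m <= b1 x + b2 x) ->
  0 < eta -> exists2 r, 0 < r & forall w x y, K w -> enorm (x - w) < r ->
    enorm (y - w) < r -> m - eta < b1 x + b2 y.
Proof.
move=> cK l1 l2 hm eta0.
have : \forall r \near (0 : R)^'+, forall w, K w -> forall x y,
    enorm (x - w) < r -> enorm (y - w) < r -> m - eta < b1 x + b2 y.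
  apply: (compact_near_coveringP K).1 => // w Kw.
  have e2 : 0 < eta / 2 by rewrite divr_gt0.
  have /l1/nearP_eball[r1 r10 h1] : b1 w - eta / 2 < b1 w by rewrite ltrBlDr ltrDl.
  have /l2/nearP_eball[r2 r20 h2] : b2 w - eta / 2 < b2 w by rewrite ltrBlDr ltrDl.
  pose r := Num.min r1 r2.
  have r0 : 0 < r by rewrite lt_min r10.
  have r2' : 0 < r / 2 by rewrite divr_gt0.
  exists (eball w (r / 2), [set i | i < r / 2]) => /=.
    by split; [exact: near_eball|exact: nbhs_right_lt].
  move=> [w' i] /= [w'w ir] x y xw yw.
  have tri u : enorm (u - w') < i -> enorm (u - w) < r.
    move=> uw; apply: le_lt_trans (enorm_triangle w' u w) _.
    by rewrite /eball/= in w'w; lra.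
  have := h1 x; rewrite /eball/= => /(_ (lt_le_trans (tri _ xw) _)).
  have := h2 y; rewrite /eball/= => /(_ (lt_le_trans (tri _ yw) _)).
  rewrite !ge_min !lexx ?orbT => /(_ isT) B2 /(_ isT) B1.
  by have := hm _ Kw; lra.
move=> near_r; near (0 : R)^'+ => r; exists r; first by near: r; exact: nbhs_right_gt.
have hr : forall w, K w -> forall x y,
    enorm (x - w) < r -> enorm (y - w) < r -> m - eta < b1 x + b2 y by near: r.
by move=> w x y Kw; exact: hr.
Unshelve. all: by end_near. Qed.

Lemma measurable_lsc_line b x z : lsc b ->
  measurable_fun setT (fun t : R => b (x + t *: z)).
Proof.
move=> lb; apply/measurable_EFinP; apply: lower_semicontinuous_measurable.
move=> t a; rewrite /= lte_fin => ab.
exists [set t' | a < b (x + t' *: z)] => //.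
exact: (lsc_comp (@continuous_line _ _ x z) lb).
Qed.

Lemma has_lbound_image b (A : set V) (M : R) : (forall x, `|b x| <= M) ->
  has_lbound (b @` A).
Proof.
move=> bM; exists (- M) => _ [x _ <-].
by have := bM x; rewrite ler_norml => /andP[].
Qed.

Lemma eball_center x (r : R) : 0 < r -> eball x r x.
Proof. by move=> r0; rewrite /eball/= subrr enorm0. Qed.

(** * Semicontinuous envelopes of bounded functions *)

Section Envelope.
Variables (b : V -> R) (M : R).
Hypothesis bM : forall x, `|b x| <= M.

Let infs x := [set inf [set b y | y in eball x r] | r in [set r : R | 0 < r]].

Lemma inf_eball_le x (r : R) : 0 < r -> inf [set b y | y in eball x r] <= b x.
Proof.
move=> r0; apply: ge_inf; first exact: has_lbound_image bM.
by exists x => //; exact: eball_center.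
Qed.

Let has_ubound_infs x : has_ubound (infs x).
Proof. by exists (b x) => _ [r r0 <-]; exact: inf_eball_le. Qed.

Let infs_neq0 x : infs x !=set0.
Proof. by eexists; exists 1 => //=. Qed.

Lemma lsc_env_le x : lsc_env b x <= b x.
Proof.
by apply: ge_sup; [exact: infs_neq0|move=> _ [r r0 <-]; exact: inf_eball_le].
Qed.

Lemma inf_eball_le_lsc_env x (r : R) : 0 < r ->
  inf [set b y | y in eball x r] <= lsc_env b x.
Proof. by move=> r0; apply: (ub_le_sup (has_ubound_infs x)); exists r. Qed.

Lemma lsc_env_bounded x : `|lsc_env b x| <= M.
Proof.
rewrite ler_norml; apply/andP; split.
  apply: le_trans (inf_eball_le_lsc_env x ltr01); apply: lb_le_inf.
    by exists (b x), x => //; exact: eball_center.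
  by move=> _ [y _ <-]; have := bM y; rewrite ler_norml => /andP[].
by apply: le_trans (lsc_env_le x) _; have := bM x; rewrite ler_norml => /andP[].
Qed.

Lemma lsc_lsc_env : lsc (lsc_env b).
Proof.
move=> x a ax.
have [_ [r /= r0 <-] ar] := sup_gt (infs_neq0 x) ax.
have r2 : 0 < r / 2 by rewrite divr_gt0.
apply/nearP_eball; exists (r / 2) => // y xy.
apply: lt_le_trans (inf_eball_le_lsc_env y r2); apply: lt_le_trans ar _.
apply: lb_le_inf; first by exists (b y), y => //; exact: eball_center.
move=> _ [w yw <-]; apply: ge_inf; first exact: has_lbound_image bM.
exists w => //; rewrite /eball/= in xy yw *.
by apply: le_lt_trans (enorm_triangle y w x) _; lra.
Qed.

End Envelope.

Lemma usc_envE b x : usc_env b x = - lsc_env (fun y => - b y) x.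
Proof.
rewrite /usc_env /lsc_env /inf; congr (- sup _).
rewrite image_comp; apply: eq_imagel => r _ /=.
congr (- sup _); rewrite image_comp; apply: eq_imagel => y _ /=.
by rewrite opprK.
Qed.

Lemma up_ext_opp (Om : set V) g b : up_ext Om g (fun x => - b x) =
  (fun x => - low_ext Om (fun y => - g y) b x).
Proof.
apply/funext => x; rewrite /up_ext /low_ext; case: ifP => // _.
by case: ifP => _; rewrite ?opprK// -[in LHS](opprK (g x)) -oppr_min.
Qed.

Lemma within_continuousN (A : set V) g : {within A, continuous g} ->
  {within A, continuous (fun x => - g x)}.
Proof.
by move=> cg x; apply: (@continuousN _ _ _ (g : subspace _ -> R)); exact: cg.
Qed.

(** * The lower extension by the exterior datum *)

Section LowExt.
Variables (Om : set V) (g b : V -> R).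
Hypothesis oOm : open Om.

Lemma low_ext_in x : Om x -> low_ext Om g b x = b x.
Proof. by move=> h; rewrite /low_ext asboolT. Qed.

Lemma low_ext_bd x : ~ Om x -> closure Om x ->
  low_ext Om g b x = Num.min (b x) (g x).
Proof. by move=> h1 h2; rewrite /low_ext asboolF// asboolT. Qed.

Lemma low_ext_out x : ~ closure Om x -> low_ext Om g b x = g x.
Proof.
move=> h; rewrite /low_ext asboolF; last by move/subset_closure.
by rewrite asboolF.
Qed.

Lemma low_ext_bounded (M : R) : (forall x, `|b x| <= M) ->
  (forall x, closure (~` Om) x -> `|g x| <= M) ->
  forall x, `|low_ext Om g b x| <= M.
Proof.
move=> bM gM x; have [Ox|Ox] := pselect (Om x); first by rewrite low_ext_in.
have gx := gM _ (subset_closure Ox).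
have [cx|cx] := pselect (closure Om x); last by rewrite low_ext_out.
by rewrite low_ext_bd// /Num.min; case: ifP.
Qed.

Lemma within_continuousP (A : set V) (h : V -> R) : {within A, continuous h} ->
  forall x e, A x -> 0 < e -> exists2 r, 0 < r &
    forall y, A y -> enorm (y - x) < r -> `|h x - h y| < e.
Proof.
move=> ch x e Ax e0.
have /cvgrPdist_lt/(_ e e0)/(nbhs_subspace_ex _ Ax)[W xW UW] := ch x.
have /nearP_eball[r r0 hr] := xW.
exists r => // y Ay xy; have : (W `&` A) y by split=> //; exact: hr.
by rewrite -UW => -[].
Qed.

(** The delicate points are on the boundary: their neighbours carry the value [b], [g] or the
    minimum of both, and near such a point [b], and [g] where it is continuous, stay above the given
    level. *)
Lemma lsc_low_ext : lsc b -> {within closure (~` Om), continuous g} ->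
  lsc (low_ext Om g b).
Proof.
move=> lb cg x a ax.
have [Ox|Ox] := pselect (Om x).
  rewrite low_ext_in// in ax.
  apply: filterS2 (lb _ _ ax) (open_nbhs_nbhs (conj oOm Ox)) => y ay Oy.
  by rewrite low_ext_in.
have near_g c : c < g x -> \forall y \near x, closure (~` Om) y -> c < g y.
  move=> cgx; have e0 : 0 < g x - c by rewrite subr_gt0.
  have [r r0 hr] := within_continuousP cg (subset_closure Ox) e0.
  apply/nearP_eball; exists r => // y xy cy.
  by have := hr y cy xy; rewrite ltr_norml => /andP[_]; lra.
have [cx|cx] := pselect (closure Om x).
  rewrite low_ext_bd// lt_min in ax; have /andP[abx agx] := ax.
  apply: filterS2 (lb _ _ abx) (near_g _ agx) => y ay gy.
  have [Oy|Oy] := pselect (Om y); first by rewrite low_ext_in.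
  have {}gy := gy (subset_closure Oy).
  have [cy|cy] := pselect (closure Om y); last by rewrite low_ext_out.
  by rewrite low_ext_bd// lt_min ay.
rewrite low_ext_out// in ax.
have oC : open (~` closure Om) by apply: closed_openC; exact: closed_closure.
apply: filterS2 (open_nbhs_nbhs (conj oC cx)) (near_g _ ax) => y cy gy.
rewrite low_ext_out//; apply: gy; apply: subset_closure => Oy.
by apply: cy; exact: subset_closure.
Qed.

End LowExt.

End Lsc.

(** * Supporting hyperplanes and caps of a strictly convex set *)

Section Geometry.
Variables (R : realType) (N : nat).
Notation V := 'rV[R]_N.
Variable Om : set V.
Hypotheses (Om0 : Om !=set0) (oOm : open Om) (bOm : ebounded Om)
  (cOm : strictly_convex Om).
Implicit Types (w x y z k p : V).

Lemma closure_ebounded : ebounded (closure Om).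
Proof.
have [M OM] := bOm; exists M => x cx; rewrite leNgt; apply/negP => Mx.
have ce : lsc (fun y : V => enorm (y - 0)).
  by apply: continuous_lsc; exact: continuous_enormB.
have /ce/cx[y [Oy]] : M < enorm (x - 0) by rewrite subr0.
by rewrite /= subr0 ltNge OM.
Qed.

Lemma compact_closure_dom : compact (closure Om).
Proof.
by apply: compact_ebounded; [exact: closed_closure|exact: closure_ebounded].
Qed.

Lemma closure_dom_neq0 : closure Om !=set0.
Proof. by have [q Oq] := Om0; exists q; exact: subset_closure. Qed.

(** The normal points from [p] to its nearest point [x1] in the closure: a small move from [x1]
    towards [w] cannot decrease the distance to [p]. *)
Lemma separate_point p : ~ closure Om p ->
  exists2 k, enorm k = 1 & forall w, closure Om w -> 0 <= dot k (w - p).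
Proof.
move=> np.
have [|x1 cx1 xmin] := compact_lsc_min (m := 0) compact_closure_dom closure_dom_neq0
  (continuous_lsc (@continuous_enormB _ _ p)).
  by move=> x _; exact: enorm_ge0.
have xp : 0 < enorm (x1 - p).
  rewrite lt_neqAle enorm_ge0 andbT eq_sym; apply/eqP => /enorm_eq0/eqP.
  by rewrite subr_eq0 => /eqP xp; rewrite -xp in np.
have key w : closure Om w -> 0 <= dot (x1 - p) (w - x1).
  move=> cw; rewrite leNgt; apply/negP => D0.
  have xw : x1 != w.
    by apply/eqP => xw; move: D0; rewrite xw subrr dotC dot0l ltxx.
  set D := dot _ _ in D0; pose W := dot (w - x1) (w - x1).
  have W0 : 0 <= W by exact: dot_ge0.
  (* Strict convexity puts the point of the segment at parameter [l] in [Om]; [l] is so small that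
     [l ^+ 2 * W] cannot offset the negative term [2 * l * D]. *)
  pose l := Num.min (1 / 2) (- D / (W + 1)).
  have l0 : 0 < l.
    by rewrite lt_min; apply/andP; split; [lra|rewrite divr_gt0//; lra].
  have l1 : l < 1 by rewrite /l gt_min; apply/orP; left; lra.
  have lW : l * W < - D.
    apply: (@le_lt_trans _ _ (- D / (W + 1) * W)).
      by rewrite ler_wpM2r// /l ge_min lexx orbT.
    rewrite mulrAC -mulrA gtr_pMr; last by lra.
    by rewrite ltr_pdivrMr; lra.
  have l01 : 0 < l < 1 by rewrite l0.
  have := xmin _ (subset_closure (cOm cx1 cw xw l01)).
  rewrite -(@ler_pXn2r _ 2) ?nnegrE ?enorm_ge0// !enorm_sqr.
  have -> : (1 - l) *: x1 + l *: w - p = (x1 - p) + l *: (w - x1).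
    by apply/rowP => i; rewrite !mxE; ring.
  rewrite dot_sqr_DZ -/D -/W => h.
  have : 0 <= l * (2 * D + l * W) by lra.
  by rewrite pmulr_rge0//; lra.
exists ((enorm (x1 - p))^-1 *: (x1 - p)).
  by rewrite enormZ ger0_norm ?invr_ge0 ?enorm_ge0// mulVf// gt_eqF.
move=> w cw; rewrite dotZl mulr_ge0 ?invr_ge0 ?enorm_ge0//.
rewrite -[w - p](subrKA x1) dotDr addr_ge0 ?dot_ge0//.
exact: key.
Qed.

Lemma compact_sphere : compact (@sphere R N).
Proof.
apply: compact_ebounded; last by exists 1 => x ->.
have -> : @sphere R N = (fun x : V => enorm (x - 0)) @^-1` [set 1].
  by apply/seteqP; split=> x; rewrite /sphere/= subr0.
by apply: closed_comp => [x _|]; [exact: continuous_enormB|exact: closed_eq].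
Qed.

(* The normals of half-spaces separating [Om] from exterior points converging
   to [x0] accumulate at a normal of a supporting half-space. *)
Lemma supporting_normal_weak x0 : closure Om x0 -> ~ Om x0 ->
  exists2 k, enorm k = 1 & forall w, Om w -> 0 <= dot k (w - x0).
Proof.
move=> cx0 nx0; apply: contrapT => nok.
have [q Oq] := Om0.
have bad k : enorm k = 1 -> exists2 w, Om w & dot k (w - x0) < 0.
  move=> k1; apply: contrapT => h; apply: nok; exists k => // w Ow.
  by rewrite leNgt; apply/negP => hw; apply: h; exists w.
(* Otherwise [x0] would lie strictly between [q] and another point of the closure, at parameter
   [(1 + t)^-1], hence in [Om]. *)
have ext (t : R) : 0 < t -> ~ closure Om (x0 + t *: (x0 - q)).
  move=> t0 ct; apply: (nx0).
  have t1 : 1 + t != 0 by rewrite gt_eqF//; lra.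
  have qx : q != x0 + t *: (x0 - q).
    apply/eqP => h; have : (1 + t) *: (x0 - q) = 0.
      by rewrite scalerDl scale1r {1}h; apply/rowP => i; rewrite !mxE; ring.
    move/eqP; rewrite scaler_eq0 (negbTE t1)/= subr_eq0 => /eqP xq.
    by apply: nx0; rewrite xq.
  have l01 : 0 < (1 + t)^-1 < 1.
    by rewrite invr_gt0 invf_lt1; [apply/andP; split; lra|lra].
  have := cOm (subset_closure Oq) ct qx l01.
  congr Om; apply/rowP => i; rewrite !mxE.
  by field.
(* A [w] violating support for [k] also does so for nearby normals and a slightly shifted base
   point. Compactness of the sphere yields one [t] for all normals, against [separate_point]. *)
have : \forall t \near (0 : R)^'+, forall k, sphere k ->
    exists2 w, Om w & dot k (w - (x0 + t *: (x0 - q))) < 0.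
  apply: (compact_near_coveringP _).1 => [|k k1]; first exact: compact_sphere.
  have [w Ow wk] := bad _ k1; pose c := - dot k (w - x0).
  have c0 : 0 < c by rewrite oppr_gt0.
  pose E := enorm (x0 - q).
  have E0 : 0 <= E by exact: enorm_ge0.
  have l1 : lsc (fun k' : V => - dot (w - x0) k').
    by apply: continuous_lsc => y; apply: (@cvgN _ _ _ (nbhs y)); exact: continuous_dot.
  have l2 : lsc (fun k' : V => - enorm (k' - 0)).
    by apply: continuous_lsc => y; apply: (@cvgN _ _ _ (nbhs y)); exact: continuous_enormB.
  exists ([set k' | c / 2 < - dot (w - x0) k' /\ - 2 < - enorm (k' - 0)],
    [set t | 0 < t /\ t < c / 2 / (2 * (E + 1))]) => /=.
    split.
      apply: filterI; [apply: l1|apply: l2].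
        by rewrite dotC -/c; lra.
      by rewrite subr0 k1; lra.
    apply: filterI; first exact: nbhs_right_gt.
    by apply: nbhs_right_lt; rewrite divr_gt0//; lra.
  move=> [k' t] /= [[h1 h2] [t0 ht]]; exists w => //.
  rewrite subr0 in h2.
  have := normr_dot_le k' (x0 - q); rewrite ler_norml => /andP[h3 _].
  have kE : enorm k' * E <= 2 * (E + 1).
    apply: (@le_trans _ _ (2 * E)); last by lra.
    by rewrite ler_wpM2r//; lra.
  have h4 : - (2 * (E + 1)) <= dot k' (x0 - q).
    by apply: le_trans h3; rewrite lerN2.
  have h5 : t * (2 * (E + 1)) < c / 2 by rewrite -ltr_pdivlMr//; lra.
  have h6 : - (t * (2 * (E + 1))) <= t * dot k' (x0 - q).
    by rewrite -mulrN ler_pM2l.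
  rewrite opprD addrA dotDr dotNr dotZr dotC; lra.
move=> near_t; near (0 : R)^'+ => t.
have t0 : 0 < t by near: t; exact: nbhs_right_gt.
have [k k1 hk] := separate_point (ext _ t0).
have ht : forall k, sphere k ->
    exists2 w, Om w & dot k (w - (x0 + t *: (x0 - q))) < 0 by near: t.
have [w Ow] := ht _ k1.
by rewrite ltNge hk//; exact: subset_closure.
Unshelve. all: by end_near. Qed.

(** If another closure point lay on the hyperplane or beyond it, its midpoint with [x0] would be in
    [Om], and a small move along [- k] would leave the half-space while staying in [Om]. *)
Lemma supporting_normal x0 : closure Om x0 -> ~ Om x0 ->
  exists2 k, enorm k = 1 &
    forall w, closure Om w -> w != x0 -> 0 < dot k (w - x0).
Proof.
move=> cx0 nx0; have [k k1 hk] := supporting_normal_weak cx0 nx0.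
exists k => // w cw wx0; rewrite ltNge; apply/negP => h.
have half : 0 < (1 / 2 : R) < 1 by apply/andP; split; lra.
pose m := (1 - 1 / 2) *: w + (1 / 2) *: x0.
have Om_m : Om m by exact: cOm.
have dm : dot k (m - x0) <= 0.
  have -> : m - x0 = (1 / 2) *: (w - x0).
    by apply/rowP => i; rewrite /m !mxE; field.
  by rewrite dotZr; lra.
have /nearP_eball[r r0 hr] := open_nbhs_nbhs (conj oOm Om_m).
have : Om (m - (r / 2) *: k).
  apply: hr; rewrite /eball/= addrC addKr enormN enormZ k1 mulr1 gtr0_norm; lra.
move/hk; rewrite addrAC dotDr dotNr dotZr -enorm_sqr k1 expr1n; lra.
Qed.

(** At distance at least [r] from [x0] the linear form has a positive minimum on the compact
    closure; [tau] is half of it. *)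
Lemma cap_shrinks x0 k (r : R) : closure Om x0 ->
  (forall w, closure Om w -> w != x0 -> 0 < dot k (w - x0)) -> 0 < r ->
  exists2 tau, 0 < tau &
    forall w, closure Om w -> dot k (w - x0) <= tau -> enorm (w - x0) < r.
Proof.
move=> cx0 hk r0.
pose K := closure Om `&` [set w | r <= enorm (w - x0)].
have cK : compact K.
  apply: compact_closedI; first exact: compact_closure_dom.
  have -> : [set w | r <= enorm (w - x0)] = (fun w : V => enorm (w - x0)) @^-1` `[r, +oo[.
    by apply/seteqP; split=> w; rewrite /= in_itv/= andbT.
  by apply: closed_comp => [w _|]; [exact: continuous_enormB|exact: interval_closed].
have pos w : K w -> 0 < dot k (w - x0).
  move=> [cw rw]; apply: hk => //; apply/eqP => wx.
  by move: rw; rewrite /= wx subrr enorm0 leNgt r0.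
have [K0|K0] := pselect (K !=set0); last first.
  exists 1 => // w cw _; rewrite ltNge; apply/negP => rw.
  by apply: K0; exists w.
have ld : lsc (fun w => dot k w - dot k x0).
  by apply: continuous_lsc => w; apply: (@cvgB _ _ _ (nbhs w)); [exact: continuous_dot|exact: cvg_cst].
have [|m Km mmin] := compact_lsc_min (m := 0) cK K0 ld.
  by move=> w /pos; rewrite dotDr dotNr => /ltW.
exists (dot k (m - x0) / 2); first by rewrite divr_gt0// pos.
move=> w cw hw; rewrite ltNge; apply/negP => rw.
have := mmin w (conj cw rw); have := pos _ Km.
move: hw; rewrite !(dotDr, dotNr); lra.
Qed.

End Geometry.

(** * Evaluating and bounding the operator *)

Section Operator.
Variables (R : realType) (N : nat) (s : R).
Hypothesis s01 : 0 < s < 1.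
Notation V := 'rV[R]_N.
Implicit Types (f : V -> R) (x y z k : V).

Let s0 : 0 < s. Proof. by case/andP: s01. Qed.

Definition incr (w : V -> R) (ux : R) x z : R -> R := fun t => w (x + t *: z) - ux.

(** For affine test functions, [al = 0], only the nonlocal term and [f] remain. *)
Lemma Ezd_quad f z (d : R) w (ux al : R) k (c : R) x : 0 < d -> enorm z = 1 ->
  Ezd s f z d w ux (quad al k c) x =
  al * (d `^ (2 - 2 * s) / (1 - s)) + tail_int s d (incr w ux x z) - f x.
Proof.
move=> d0 z1; rewrite /Ezd; congr (_ + _ - _).
by apply: pv_int_quad => // t; exact: quad_line.
Qed.

Lemma measurable_incr w (ux : R) x z : lsc w -> measurable_fun setT (incr w ux x z).
Proof. by move=> lw; apply: measurable_funB => //; exact: measurable_lsc_line. Qed.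

Lemma incr_bounded w (ux M : R) x z : (forall y, `|w y| <= M) -> `|ux| <= M ->
  forall t, `|incr w ux x z t| <= 2 * M.
Proof.
move=> wM uM t; rewrite (le_trans (ler_normB _ _))//.
by have := wM (x + t *: z); lra.
Qed.

Lemma incrN w (ux : R) x z :
  incr (fun y => - w y) (- ux) x z = (fun t => - incr w ux x z t).
Proof. by apply/funext => t; rewrite /incr opprB opprK addrC. Qed.

Lemma tail_int_incrN w (ux M d : R) x z : lsc w -> (forall y, `|w y| <= M) ->
  `|ux| <= M -> 0 < d ->
  tail_int s d (incr (fun y => - w y) (- ux) x z) = - tail_int s d (incr w ux x z).
Proof.
move=> lw wM uM d0; rewrite incrN.
apply: (tail_intN s0 d0); first exact: measurable_incr.
exact: incr_bounded.
Qed.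

(** The bound is uniform in the direction: after a change of sign it bounds the values over the
    sphere from below, so that their [inf] is a true infimum. *)
Lemma tail_int_incr_le w (ux M d : R) x z : lsc w -> (forall y, `|w y| <= M) ->
  `|ux| <= M -> 0 < d ->
  tail_int s d (incr w ux x z) <= 2 * M * d `^ (- (2 * s)) / s.
Proof.
move=> lw wM uM d0.
have M0 : 0 <= M by exact: le_trans (normr_ge0 _) uM.
have Fb := incr_bounded x z wM uM.
have := tail_int_le (x1 := 4 * M) (x2 := 0) (x3 := 0) s0 d0 (measurable_incr ux x z lw)
  Fb (lexx d) (lexx d) (lexx d).
rewrite !mul0r !addr0 => h; apply: le_trans (h _) _.
  move=> t dt; rewrite /tail_ind ger0_norm ?dt ?mulr1 ?mul0r ?addr0; last first.
    by rewrite (le_trans (ltW d0)).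
  by have := Fb t; have := Fb (- t); rewrite !ler_norml; lra.
rewrite le_eqVlt; apply/orP; left; apply/eqP; field.
by rewrite gt_eqF.
Qed.

(** * The barrier at a boundary point *)

Section Barrier.
Variables (Om : set V) (f g b : V -> R) (M Mf : R).
Hypotheses (Om0 : Om !=set0) (oOm : open Om) (bOm : ebounded Om)
  (cOm : strictly_convex Om).
Hypotheses (fM : forall x, closure Om x -> `|f x| <= Mf)
  (cg : {within closure (~` Om), continuous g})
  (gM : forall x, closure (~` Om) x -> `|g x| <= M)
  (lb : lsc b) (bM : forall x, `|b x| <= M)
  (bg : forall x, ~ closure Om x -> g x <= b x).

(** [P] is comparable to the largest half-length of a chord centred at [y]. It is small because one
    end of such a chord is no higher than [y], hence in the small cap; the slope is small because
    both ends lie on the nonnegative side of the supporting hyperplane. *)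
Lemma half_chord x0 y k z (d K sig r : R) : 0 < d -> 2 * d <= r -> 0 < K ->
  K * d <= sig -> enorm k = 1 -> enorm z = 1 ->
  (forall w, closure Om w -> 0 <= dot k (w - x0)) ->
  (forall w, closure Om w -> dot k (w - x0) <= dot k (y - x0) ->
     2 * enorm (w - x0) < r) ->
  closure Om y -> K * dot k (y - x0) <= sig ->
  exists P, [/\ d <= P, P < r, K * (`|dot k z| * P) <= sig &
    forall t, 2 * P <= t ->
      ~ (closure Om (y + t *: z) /\ closure Om (y - t *: z))].
Proof.
move=> d0 dr K0 Kd k1 z1 l_ge0 hcap cy Kly.
pose a := dot k z.
have a1 : `|a| <= 1 by have := normr_dot_le k z; rewrite k1 z1 mul1r.
(* The element [d] makes the set nonempty, and all its elements are at least [d]. *)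
pose T : set R := [set t | t = d \/
  [/\ d <= t, closure Om (y + t *: z) & closure Om (y - t *: z)]].
have lline (t : R) : dot k (y + t *: z - x0) = dot k (y - x0) + t * a.
  by rewrite /a !dotE; ring.
have dist_line (t : R) : enorm (y + t *: z - y) = `|t|.
  by rewrite addrC addKr enormZ z1 mulr1.
have T_small t : T t -> t < r.
  case=> [->|[dt ct1 ct2]]; first by lra.
  have t0 : 0 < t by exact: lt_le_trans dt.
  have in_cap (u : R) : `|u| = t -> closure Om (y + u *: z) -> u * a <= 0 -> t < r.
    move=> ut cu ua; have := hcap _ cu; rewrite lline gerDl => /(_ ua).
    have := hcap _ cy (lexx _).
    have := enorm_triangle x0 (y + u *: z) y; rewrite dist_line ut (enormBC x0 y).
    by lra.
  have [a0|a0] := leP a 0.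
    by apply: (in_cap t) => //; [rewrite gtr0_norm|rewrite pmulr_rle0].
  apply: (in_cap (- t)); first by rewrite normrN gtr0_norm.
    by rewrite scaleNr.
  by rewrite mulNr oppr_le0 mulr_ge0 ?ltW.
have T_slope t : T t -> K * (`|a| * t) <= sig.
  case=> [->|[dt ct1 ct2]].
    apply: le_trans Kd; rewrite ler_pM2l//.
    by rewrite -[leRHS]mul1r ler_pM2r.
  have t0 : 0 < t by exact: lt_le_trans dt.
  have h1 := l_ge0 _ ct1; have h2 : 0 <= dot k (y + (- t) *: z - x0).
    by apply: l_ge0; rewrite scaleNr.
  rewrite !lline in h1 h2; apply: le_trans Kly; rewrite ler_pM2l//.
  have [a0|a0] := leP 0 a; [rewrite ger0_norm//|rewrite ltr0_norm//].
    by lra.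
  by lra.
have supT : has_sup T.
  by split; [exists d; left|exists r => t /T_small/ltW].
have dT : d <= sup T by apply: ub_le_sup; [exact: supT.2|left].
(* An element above half the supremum: [2 * P] then exceeds every half-length. *)
have sT0 : 0 < sup T / 2 by rewrite divr_gt0// (lt_le_trans d0).
have [P TP supP] := sup_adherent sT0 supT.
have dP : d <= P by case: TP => [->//|[]].
exists P; split=> //; [exact: T_small|exact: T_slope|].
move=> t Pt [c1 c2]; have : t <= sup T.
  apply: ub_le_sup; first exact: supT.2.
  by right; split=> //; lra.
by lra.
Qed.

(** Outside the closure the increment is at least [3 / 4 * c]; inside, it dominates a linear
    function of size at most [c / 4]. With both points inside, the linear parts cancel in the sum;
    otherwise the outside point outweighs the slope. *)
Lemma barrier_line x0 y k z (K c rho LP : R) : 0 < K -> 0 < c ->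
  (forall w, ~ Om w -> enorm (w - x0) < rho -> b y + 3 / 4 * c <= g w) ->
  (forall w, closure Om w -> b y - K * dot k (w - y) <= b w) ->
  (forall u : R, `|u| < LP -> enorm (y + u *: z - x0) < rho) ->
  (forall u : R, `|u| < LP -> K * `|dot k z * u| <= c / 4) ->
  let F := incr (low_ext Om g b) (b y) y z in
  forall t, 0 <= t -> t < LP -> 0 <= F t + F (- t) /\
    (~ (closure Om (y + t *: z) /\ closure Om (y - t *: z)) ->
      c / 4 <= F t + F (- t)).
Proof.
move=> K0 c0 g_ge b_ge near_line slope F.
pose a := dot k z.
have F_out (u : R) : `|u| < LP -> ~ closure Om (y + u *: z) -> 3 / 4 * c <= F u.
  move=> uLP nu; rewrite /F /incr low_ext_out//.
  have nO : ~ Om (y + u *: z) by move/subset_closure.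
  by rewrite lerBrDl; exact: g_ge nO (near_line _ uLP).
(* The minimum accounts for boundary points, where the extension may equal [g]. *)
have F_in (u : R) : `|u| < LP -> closure Om (y + u *: z) ->
    Num.min (- (K * (a * u))) (3 / 4 * c) <= F u.
  move=> uLP cu; rewrite /F /incr ge_min !lerBrDl.
  have hb := b_ge _ cu.
  have e1 : y + u *: z - y = u *: z by rewrite addrC addKr.
  rewrite e1 dotZr (mulrC u) in hb.
  have [Ou|Ou] := pselect (Om (y + u *: z)); first by rewrite low_ext_in// hb.
  rewrite low_ext_bd//; have := g_ge _ Ou (near_line _ uLP) => hg.
  by rewrite /Num.min; case: ifP => _; rewrite ?hb ?hg ?orbT.
have F_ge (u : R) : `|u| < LP -> - (K * `|a * u|) <= F u.
  move=> uLP; have h0 := mulr_ge0 (ltW K0) (normr_ge0 (a * u)).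
  have h1 : - (K * `|a * u|) <= 3 / 4 * c by lra.
  have [cu|cu] := pselect (closure Om (y + u *: z)).
    apply: le_trans (F_in _ uLP cu).
    by rewrite le_min h1 andbT lerN2 ler_pM2l// ler_norm.
  exact: le_trans (F_out _ uLP cu).
move=> t t0 tLP.
have tn : `|t| < LP by rewrite ger0_norm.
have tn' : `|- t| < LP by rewrite normrN.
have h3 := slope _ tn; rewrite -/a in h3.
have S_not : ~ (closure Om (y + t *: z) /\ closure Om (y - t *: z)) ->
    c / 4 <= F t + F (- t).
  move=> nb; have h1 := F_ge _ tn; have h2 := F_ge _ tn'.
  rewrite mulrN normrN in h2.
  have [c1|c1] := pselect (closure Om (y + t *: z)).
    have c2 : ~ closure Om (y + (- t) *: z).
      by move=> c2; apply: nb; rewrite -scaleNr.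
    by have := F_out _ tn' c2; lra.
  by have := F_out _ tn c1; lra.
split=> //.
have [[c1 c2]|nb] := pselect (closure Om (y + t *: z) /\ closure Om (y - t *: z));
  last by have := S_not nb; lra.
rewrite -scaleNr in c2.
have := F_in _ tn c1; have := F_in _ tn' c2; rewrite mulrN mulrN opprK.
have : `|K * (a * t)| <= c / 4 by rewrite normrM gtr0_norm.
rewrite ler_norml => /andP[h4 h5].
have h6 : K * (a * t) <= 3 / 4 * c by lra.
have h7 : - (K * (a * t)) <= 3 / 4 * c by lra.
by rewrite !min_l//; lra.
Qed.

(* The test function is affine, so it is not seen by the singular part of the
   operator; along every line through [y] the exterior datum, which exceeds
   [b y] by a fixed amount, is met at a distance [P] so small that its
   contribution, of order [P^(-2s)], dominates. *)
Lemma boundary_barrier x0 : closure Om x0 -> ~ Om x0 -> b x0 < g x0 ->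
  exists y (d : R) k, [/\ closure Om y, 0 < d,
    forall w, eball y d w -> b w - quad 0 k 0 w >= b y - quad 0 k 0 y,
    ~ Om y -> b y < g y &
    forall z, enorm z = 1 ->
      1 <= Ezd s f z d (low_ext Om g b) (b y) (quad 0 k 0) y].
Proof.
move=> cx0 nx0 bgx0.
have M0 : 0 <= M by exact: le_trans (normr_ge0 _) (bM x0).
have Mf0 : 0 <= Mf by exact: le_trans (normr_ge0 _) (fM cx0).
pose c := g x0 - b x0; have c0 : 0 < c by rewrite subr_gt0.
have [k k1 hk] := supporting_normal Om0 oOm bOm cOm cx0 nx0.
pose l w := dot k (w - x0).
have l_ge0 w : closure Om w -> 0 <= l w.
  move=> cw; have [->|wx] := eqVneq w x0; first by rewrite /l subrr dotC dot0l.
  exact/ltW/hk.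
have c4 : 0 < c / 4 by rewrite divr_gt0.
have [rho rho0 hrho] := within_continuousP cg (subset_closure nx0) c4.
have g_ge w : ~ Om w -> enorm (w - x0) < rho -> b x0 + 3 / 4 * c <= g w.
  move=> nw wx; have := hrho w (subset_closure nw) wx.
  by rewrite ltr_norml => /andP[_]; rewrite /c; lra.
pose C := 4 * M + c / 4.
have C0 : 0 < C by rewrite /C; lra.
have p0 : 0 < 2 * s by rewrite mulr_gt0.
pose two := (2 : R) `^ (- (2 * s)).
have two0 : 0 < two by exact: powR_gt0.
have q0 : 0 < c / 8 * two / C by rewrite divr_gt0// mulr_gt0// divr_gt0.
have [X X0 hX] := powR_neg_le_near_infty p0 q0.
(* Up to [L * P] the datum near [x0] controls the increments; the loss beyond is absorbed through
   [hL]. *)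
pose L := Num.max X 2.
have L2 : 2 <= L by rewrite le_max lexx orbT.
have hL : C * L `^ (- (2 * s)) <= c / 8 * two.
  by rewrite mulrC -ler_pdivlMr// hX// le_max lexx.
pose gam := c / 8 * two / (2 * s).
have gam0 : 0 < gam by rewrite divr_gt0// mulr_gt0// divr_gt0.
(* For [P <= r2] the gain is at least [Mf + 1], enough to beat [f] by 1. *)
have [r2 r20 hr2] := powR_neg_ge_near0 ((Mf + 1) / gam) p0.
(* A linear term bounded by [sig] at length [P] stays below [c / 4] up to length [L * P]. *)
pose sig := c / (4 * L).
have L0 : 0 < L by lra.
have sig0 : 0 < sig by rewrite divr_gt0//; lra.
have sigL : sig * L = c / 4 by rewrite /sig; field; rewrite gt_eqF.
pose r3 := Num.min r2 (rho / 2 / L).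
have r30 : 0 < r3 by rewrite lt_min r20 !divr_gt0.
have /lb/nearP_eball[r4 r40 hr4] : b x0 - sig < b x0 by rewrite ltrBlDr ltrDl.
(* A cap of radius [r1] makes [P < r3], stays where [g] is close to [g x0], and where [b] exceeds
   [b x0 - sig]. *)
pose r1 := Num.min (r3 / 2) (Num.min (rho / 2) r4).
have r10 : 0 < r1 by rewrite !lt_min !divr_gt0.
have r1r3 : r1 <= r3 / 2 by rewrite ge_min lexx.
have r1rho : r1 <= rho / 2 by rewrite !ge_min lexx !orbT.
have r1r4 : r1 <= r4 by rewrite !ge_min lexx !orbT.
have [tau tau0 htau] := cap_shrinks bOm cx0 hk r10.
(* So steep that the minimiser of [b + K * l] has height at most [tau], as [b] oscillates by at most
   [2 * M]. *)
pose K := 2 * M / tau + 1.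
have K0 : 0 < K by rewrite ltr_wpDl// divr_ge0 ?mulr_ge0// ltW.
have Ktau : 2 * M <= K * tau.
  have -> : K * tau = 2 * M + tau by rewrite /K; field; rewrite gt_eqF.
  by rewrite lerDl ltW.
have lbK : lsc (fun w => b w + K * l w).
  apply: lscD => //; apply: continuous_lsc => w.
  have -> : (fun w => K * l w) = (fun w => dot (K *: k) w - K * dot k x0).
    by apply/funext => v; rewrite /l dotDr dotNr dotZl mulrBr.
  by apply: (@cvgB _ _ _ (nbhs w)); [exact: continuous_dot|exact: cvg_cst].
have [|y cy ymin] := compact_lsc_min (m := - M) (compact_closure_dom bOm)
    (closure_dom_neq0 Om0) lbK.
  move=> w cw; have := bM w; rewrite ler_norml => /andP[h _].
  by have := mulr_ge0 (ltW K0) (l_ge0 _ cw); lra.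
have lx0 : l x0 = 0 by rewrite /l subrr dotC dot0l.
have yx0 : b y + K * l y <= b x0 by have := ymin _ cx0; rewrite lx0 mulr0 addr0.
have Kly0 : 0 <= K * l y by rewrite mulr_ge0 ?l_ge0 ?ltW.
have lytau : l y <= tau.
  rewrite -(ler_pM2l K0); apply: le_trans Ktau.
  have := bM y; have := bM x0; rewrite !ler_norml; lra.
have yr1 : enorm (y - x0) < r1 by exact: htau.
have Kly : K * l y <= sig.
  have := hr4 y; rewrite /eball/= => /(_ (lt_le_trans yr1 r1r4)); lra.
(* [K * d <= sig] keeps the touching condition at points of the ball outside the closure, where
   [b >= g] is well above [b y]. *)
pose d := Num.min (r3 / 2) (sig / K).
have d0 : 0 < d by rewrite lt_min (divr_gt0 sig0 K0) divr_gt0.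
have dr3 : d <= r3 / 2 by rewrite ge_min lexx.
have Kd : K * d <= sig by rewrite mulrC -ler_pdivlMr// ge_min lexx orbT.
have r3rho : r3 * L <= rho / 2 by rewrite -ler_pdivlMr// ge_min lexx orbT.
have r3rho' : r3 <= rho / 4.
  have : r3 * 2 <= rho / 2 by apply: le_trans r3rho; rewrite ler_pM2l.
  by lra.
have sigc : sig <= c / 8.
  by have : sig * 2 <= c / 4; [rewrite -sigL ler_pM2l|lra].
have by_le : b y <= b x0 by lra.
have b_ge w : closure Om w -> b y - K * dot k (w - y) <= b w.
  move=> cw; have := ymin _ cw; rewrite /l.
  by rewrite !dotDr !dotNr; lra.
exists y, d, (- K *: k); split => //.
- move=> w yw; rewrite /eball/= in yw.
  have -> : quad 0 (- K *: k) 0 w = quad 0 (- K *: k) 0 y - K * dot k (w - y).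
    by rewrite /quad !dotE; ring.
  have [cw|cw] := pselect (closure Om w); first by have := b_ge _ cw; lra.
  have wx : enorm (w - x0) < rho.
    by apply: le_lt_trans (enorm_triangle y w x0) _; lra.
  have nw : ~ Om w by move/subset_closure.
  have h1 := le_trans (g_ge _ nw wx) (bg cw).
  have h2 : - d <= dot k (w - y).
    have := normr_dot_le k (w - y); rewrite k1 mul1r ler_norml => /andP[h _].
    by apply: le_trans h; rewrite lerN2 ltW.
  have h3 : - (K * d) <= K * dot k (w - y) by rewrite -mulrN ler_pM2l.
  by lra.
- by move=> ny; have := g_ge _ ny; lra.
move=> z z1; rewrite Ezd_quad// mul0r add0r.
have lw : lsc (low_ext Om g b) by exact: lsc_low_ext.
have wM := low_ext_bounded bM gM.
have Fb := incr_bounded y z wM (bM y).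
set F := incr _ _ _ _ in Fb *.
have d2r3 : 2 * d <= r3 by lra.
have hcap w : closure Om w -> dot k (w - x0) <= dot k (y - x0) ->
    2 * enorm (w - x0) < r3.
  by move=> cw h; have := htau w cw (le_trans h lytau); lra.
have [P [dP Pr3 slopeP nbP]] := half_chord d0 d2r3 K0 Kd k1 z1 l_ge0 hcap cy Kly.
have P0 : 0 < P by exact: lt_le_trans dP.
have LPrho : L * P <= rho / 2.
  by apply: le_trans r3rho; rewrite mulrC ler_pM2r// ltW.
have g_ge' w : ~ Om w -> enorm (w - x0) < rho -> b y + 3 / 4 * c <= g w.
  by move=> nw wx; apply: le_trans (g_ge _ nw wx); rewrite lerD2r.
have near_line (u : R) : `|u| < L * P -> enorm (y + u *: z - x0) < rho.
  move=> uLP; apply: le_lt_trans (enorm_triangle y _ x0) _.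
  have e1 : y + u *: z - y = u *: z by rewrite addrC addKr.
  rewrite e1 enormZ z1 mulr1; lra.
have slope (u : R) : `|u| < L * P -> K * `|dot k z * u| <= c / 4.
  move=> uLP; rewrite normrM -sigL.
  apply: (@le_trans _ _ (K * (`|dot k z| * (L * P)))).
    by rewrite ler_pM2l// ler_wpM2l// ltW.
  have -> : K * (`|dot k z| * (L * P)) = K * (`|dot k z| * P) * L by ring.
  by rewrite ler_pM2r.
have line := barrier_line K0 c0 g_ge' b_ge near_line slope.
have hI : gam * P `^ (- (2 * s)) <= tail_int s d F.
  apply: (@tail_int_two_steps_ge _ _ _ _ M _ L) => //.
  - exact: measurable_incr.
  - by move=> t t0 tLP; have [] := line t t0 tLP.
  - move=> t t1 tLP; have t0 : 0 <= t by lra.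
    by have [_] := line t t0 tLP; apply; exact: nbP.
have hP : (Mf + 1) / gam <= P `^ (- (2 * s)).
  by apply: hr2 => //; rewrite (le_trans (ltW Pr3))// ge_min lexx.
have h4 : Mf + 1 <= gam * P `^ (- (2 * s)) by rewrite mulrC -ler_pdivrMr.
by have := fM cy; rewrite ler_norml => /andP[_ h5]; lra.
Qed.

End Barrier.
End Operator.

(** * From infima over directions to single directions; uniform continuity *)

Section Comparison.
Variables (R : realType) (N : nat) (s : R).
Hypothesis s01 : 0 < s < 1.
Notation V := 'rV[R]_N.
Implicit Types (f g a b : V -> R) (x y z k p : V).

Let s0 : 0 < s. Proof. by case/andP: s01. Qed.

(** A nonnegative infimum bounds every direction only if the values are bounded below, since [inf]
    of an unbounded set is a default value; hence the explicit lower bound. *)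
Lemma Ezd_ge0_of_Ed_le0 f a (ux al c M d : R) k x : lsc a ->
  (forall y, `|a y| <= M) -> `|ux| <= M -> 0 < d ->
  Ed s f d (fun y => - a y) (- ux) (quad al k c) x <= 0 ->
  forall z, enorm z = 1 -> 0 <= Ezd s f z d (fun y => - a y) (- ux) (quad al k c) x.
Proof.
move=> la aM uM d0; rewrite /Ed oppr_le0 => hinf z z1; apply: le_trans hinf _.
apply: ge_inf; last by exists z.
exists (al * (d `^ (2 - 2 * s) / (1 - s)) - 2 * M * d `^ (- (2 * s)) / s - f x).
move=> _ [z' z'1 <-]; rewrite Ezd_quad// (tail_int_incrN s01 _ _ la aM uM d0).
by rewrite lerD2r lerD2l lerN2 tail_int_incr_le.
Qed.

(** The infimum need not be attained, hence the slack [eta]; [0 < N] makes the sphere nonempty. *)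
Lemma exists_Ezd_lt_of_Ed_ge0 f b (ux d : R) (phi : V -> R) x (eta : R) :
  (0 < N)%N -> 0 <= Ed s f d b ux phi x -> 0 < eta ->
  exists2 z, enorm z = 1 & Ezd s f z d b ux phi x < eta.
Proof.
move=> N0; rewrite /Ed oppr_ge0 => hinf eta0; apply: contrapT => h.
have : eta <= inf [set Ezd s f z d b ux phi x | z in @sphere R N].
  apply: lb_le_inf.
    by have [z z1] := sphere_neq0 R N0; exists (Ezd s f z d b ux phi x), z.
  move=> _ [z z1 <-]; rewrite leNgt; apply/negP => hz.
  by apply: h; exists z.
by lra.
Qed.

Lemma compact_unif_continuous (K : set V) f (e : R) : compact K ->
  {within K, continuous f} -> 0 < e ->
  exists2 r, 0 < r & forall x y, K x -> K y -> enorm (y - x) < r -> f x - f y < e.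
Proof.
move=> cK cf e0.
have : \forall r \near (0 : R)^'+, forall w, K w -> forall x y, K x -> K y ->
    enorm (x - w) < r -> enorm (y - w) < r -> f x - f y < e.
  apply: (compact_near_coveringP K).1 => // w Kw.
  have e2 : 0 < e / 2 by rewrite divr_gt0.
  have [r r0 hr] := within_continuousP cf Kw e2.
  have r2 : 0 < r / 2 by rewrite divr_gt0.
  exists (eball w (r / 2), [set i | i < r / 2]) => /=.
    by split; [exact: near_eball|exact: nbhs_right_lt].
  move=> [w' i] /= [w'w ir] x y Kx Ky xw yw.
  have tri (p : V) : enorm (p - w') < i -> enorm (p - w) < r.
    move=> pw; apply: le_lt_trans (enorm_triangle w' p w) _.
    by rewrite /eball/= in w'w; lra.
  have := hr x Kx (tri _ xw); have := hr y Ky (tri _ yw).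
  by rewrite !ltr_norml => /andP[h1 h2] /andP[h3 h4]; lra.
move=> near_r; near (0 : R)^'+ => r.
have r0 : 0 < r by near: r; exact: nbhs_right_gt.
exists r => //.
have hr : forall w, K w -> forall x y, K x -> K y ->
    enorm (x - w) < r -> enorm (y - w) < r -> f x - f y < e by near: r.
by move=> x y Kx Ky xy; apply: (hr x) => //; rewrite subrr enorm0.
Unshelve. all: by end_near. Qed.

Lemma compact_cball (r : R) : compact [set x : V | enorm x <= r].
Proof.
apply: compact_ebounded; last by exists r.
have -> : [set x : V | enorm x <= r] = (fun x : V => enorm (x - 0)) @^-1` `]-oo, r].
  by apply/seteqP; split=> x; rewrite /= in_itv/= subr0.
by apply: closed_comp => [x _|]; [exact: continuous_enormB|exact: interval_closed].
Qed.

(** * Doubling of variables *)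

Section Doubling.
Variables (Om : set V) (f a b : V -> R) (M : R).
Hypotheses (oOm : open Om) (bOm : ebounded Om)
  (cf : {within closure Om, continuous f})
  (la : lsc a) (lb : lsc b)
  (aM : forall x, `|a x| <= M) (bM : forall x, `|b x| <= M)
  (ab_out : forall x, ~ Om x -> 0 <= a x + b x).
(* [- a] and [b] are sub- and supersolutions in [Om], for quadratic test
   functions and small balls. *)
Hypothesis sub_a : forall x (d al c : R) k, 0 < d -> eball x d `<=` Om ->
  (forall y, eball x d y -> - a y - quad al k c y <= - a x - quad al k c x) ->
  forall z, enorm z = 1 -> 0 <= Ezd s f z d (fun y => - a y) (- a x) (quad al k c) x.
Hypothesis super_b : forall x (d al c : R) k (eta : R), 0 < d -> eball x d `<=` Om ->
  (forall y, eball x d y -> b y - quad al k c y >= b x - quad al k c x) ->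
  0 < eta -> exists2 z, enorm z = 1 & Ezd s f z d b (b x) (quad al k c) x < eta.

Lemma doubling_min (n Rd : R) x1 : 0 <= n -> enorm x1 <= Rd ->
  exists x y, [/\ enorm x <= Rd, enorm y <= Rd & forall x' y',
    enorm x' <= Rd -> enorm y' <= Rd ->
    a x + b y + n * enorm (x - y) ^+ 2 <= a x' + b y' + n * enorm (x' - y') ^+ 2].
Proof.
move=> n0 x1R.
pose K : set V := [set x | enorm x <= Rd].
have cK : compact (K `*` K) by apply: compact_setX; exact: compact_cball.
have K0 : K `*` K !=set0 by exists (x1, x1).
pose Phi (q : V * V) := a q.1 + b q.2 + n * enorm (q.1 - q.2) ^+ 2.
have lPhi : lsc Phi.
  apply: lscD; first apply: lscD.
  - by apply: (lsc_comp _ la) => q; exact: cvg_fst.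
  - by apply: (lsc_comp _ lb) => q; exact: cvg_snd.
  apply: continuous_lsc => q.
  have cd : {for q, continuous (fun q : V * V => enorm (q.1 - q.2 - 0))}.
    apply: (@continuous_comp _ _ _ (fun q : V * V => q.1 - q.2)
      (fun y : V => enorm (y - 0))); last exact: continuous_enormB.
    by apply: cvgB; [exact: cvg_fst|exact: cvg_snd].
  have -> : (fun q : V * V => n * enorm (q.1 - q.2) ^+ 2) =
      (fun q : V * V => n * (enorm (q.1 - q.2 - 0) * enorm (q.1 - q.2 - 0))).
    by apply/funext => q'; rewrite subr0.
  apply: (@cvgM _ _ (nbhs q)); first exact: cvg_cst.
  by apply: (@cvgM _ _ (nbhs q)).
have [|[x y] [/= Kx Ky] xymin] := compact_lsc_min (m := - (2 * M)) cK K0 lPhi.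
  move=> q _; have := aM q.1; have := bM q.2.
  have := mulr_ge0 n0 (sqr_ge0 (enorm (q.1 - q.2))).
  by rewrite /Phi !ler_norml => h1 /andP[h2 _] /andP[h3 _]; lra.
by exists x, y; split=> // x' y' Kx' Ky'; exact: (xymin (x', y')).
Qed.

Lemma doubling x : 0 <= a x + b x.
Proof.
rewrite leNgt; apply/negP; move: x => x1 abx1.
have M0 : 0 <= M by exact: le_trans (normr_ge0 _) (aM x1).
have [R1 OR1] := bOm.
pose R0 := Num.max R1 0.
have R00 : 0 <= R0 by rewrite le_max lexx orbT.
have OR x : Om x -> enorm x <= R0 by move=> /OR1; rewrite le_max => ->.
pose E := range (fun x => a x + b x).
have lE : has_lbound E.
  exists (- (2 * M)) => _ [x _ <-]; have := aM x; have := bM x.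
  by rewrite !ler_norml => /andP[h1 _] /andP[h2 _]; lra.
(* The infimum runs over the whole space, so that it also bounds points translated out of [Om]. *)
pose m := - inf E.
have mP x : - m <= a x + b x by rewrite opprK; apply: ge_inf => //; exists x.
have m0 : 0 < m by have := mP x1; lra.
have m2 : 0 < m / 2 by rewrite divr_gt0.
have cOut (r : R) : compact ([set x | enorm x <= r] `&` ~` Om).
  by apply: compact_closedI; [exact: compact_cball|exact: open_closedC].
(* Close to the complement of [Om] the doubled sum exceeds [- (m / 2)], so a minimising pair stays
   away from it, at a distance independent of the penalty [n]. *)
have [d1 d10 hd1] := compact_lsc_diag (m := 0) (cOut (R0 + 1)) la lb
  (fun x h => ab_out h.2) m2.
pose d0 := Num.min (d1 / 2) 1.
have d00 : 0 < d0 by rewrite lt_min divr_gt0//=.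
have d0d1 : d0 <= d1 / 2 by rewrite ge_min lexx.
have d0le1 : d0 <= 1 by rewrite ge_min lexx orbT.
(* Exceeds the diameter of [Om]: a displacement of length at least [D] leaves it. *)
pose D := 2 * R0 + 1.
have D0 : 0 < D by rewrite /D; lra.
have d0D : d0 <= D by rewrite /D; lra.
have p0 : 0 < 2 * s by rewrite mulr_gt0.
pose q (t : R) := t `^ (- (2 * s)).
have qD0 : 0 < q D by exact: powR_gt0.
have qd0 : 0 < q d0 by exact: powR_gt0.
(* [8 * M] bounds two increments beyond [T], and [2 * m] undoes the negative step begun at [D]. *)
pose C := 8 * M + 2 * m.
have C0 : 0 < C by rewrite /C; lra.
have e1 : 0 < m * q D / 2 / C by rewrite !divr_gt0// mulr_gt0.
have [X X0 hX] := powR_neg_le_near_infty p0 e1.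
pose T := Num.max X D.
have DT : D <= T by rewrite le_max lexx orbT.
have T0 : 0 < T by exact: lt_le_trans DT.
have hT : C * q T <= m * q D / 2.
  by rewrite mulrC -ler_pdivlMr// /q hX// le_max lexx.
(* The errors from [eta] and from beyond [T] each use at most [m * q D / 2] of the gain
   [2 * m * q D]; what is left gives [gam]. *)
pose eta := m * q D / 4 / q d0.
have eta0 : 0 < eta by rewrite !divr_gt0// mulr_gt0.
have heta : eta * q d0 = m * q D / 4 by rewrite /eta divfK// gt_eqF.
pose gam := m * q D / (2 * s).
have gam0 : 0 < gam by rewrite divr_gt0// mulr_gt0.
have g4 : 0 < gam / 4 by rewrite divr_gt0.
have [ra ra0 hra] := compact_lsc_diag (compact_cball (r := R0 + T)) la lb
  (fun x _ => mP x) eta0.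
have [rb rb0 hrb] := compact_lsc_diag (m := 0) (cOut (R0 + T)) la lb
  (fun x h => ab_out h.2) eta0.
have [rf rf0 hrf] := compact_unif_continuous (compact_closure_dom bOm) cf g4.
pose r := Num.min (Num.min ra rb) (Num.min rf (d1 / 2)).
have r0 : 0 < r by rewrite !lt_min ra0 rb0 rf0 divr_gt0.
have rra : r <= ra by rewrite !ge_min lexx.
have rrb : r <= rb by rewrite !ge_min lexx !orbT.
have rrf : r <= rf by rewrite !ge_min lexx !orbT.
have rd1 : r <= d1 / 2 by rewrite !ge_min lexx !orbT.
(* Large enough for the penalty to force the two points within [r]. *)
pose n := 2 * M / r ^+ 2 + 1.
have n1 : 1 <= n by rewrite lerDr divr_ge0 ?sqr_ge0// mulr_ge0.
have n0 : 0 < n by lra.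
have nr : 2 * M < n * r ^+ 2.
  have -> : n * r ^+ 2 = 2 * M + r ^+ 2 by rewrite /n; field; rewrite gt_eqF.
  by rewrite ltrDl exprn_gt0.
have Omx1 : Om x1 by apply: contrapT => /ab_out; lra.
have [x [y [xR yR xymin]]] := doubling_min (ltW n0) (OR _ Omx1).
have nxy : 0 <= n * enorm (x - y) ^+ 2 by rewrite mulr_ge0 ?sqr_ge0 ?ltW.
have diag w : enorm w <= R0 -> a x + b y + n * enorm (x - y) ^+ 2 <= a w + b w.
  by move=> wR; have := xymin w w wR wR; rewrite subrr enorm0 expr0n/= mulr0 addr0.
(* Comparison with diagonal pairs; outside [Om] the sum is nonnegative, so [x1] already does
   better. *)
have xy_m : a x + b y <= - m.
  rewrite opprK; apply: lb_le_inf; first by exists (a x1 + b x1), x1.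
  move=> _ [w _ <-]; have [wR|wR] := leP (enorm w) R0; first by have := diag _ wR; lra.
  have /ab_out h : ~ Om w by move=> /OR; rewrite leNgt wR.
  by have := diag _ (OR _ Omx1); lra.
have xyr : enorm (y - x) < r.
  rewrite enormBC -(@ltr_pXn2r _ 2) ?nnegrE ?enorm_ge0 ?(ltW r0)//.
  rewrite -(ltr_pM2l n0); apply: le_lt_trans nr.
  have := diag _ (OR _ Omx1); have := aM x; have := bM y.
  by rewrite !ler_norml => /andP[h1 _] /andP[h2 _]; lra.
have ball_x : eball x d0 `<=` Om.
  move=> p; rewrite /eball/= => xp; apply: contrapT => np.
  have pR : enorm p <= R0 + 1.
    by have := enormD (p - x) x; rewrite subrK; lra.
  have h1 : enorm (x - p) < d1 by rewrite enormBC; lra.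
  have h2 : enorm (y - p) < d1.
    by apply: le_lt_trans (enorm_triangle x y p) _; rewrite (enormBC x p); lra.
  by have := hd1 p x y (conj pR np) h1 h2; lra.
have ball_y : eball y d0 `<=` Om.
  move=> p; rewrite /eball/= => yp; apply: contrapT => np.
  have pR : enorm p <= R0 + 1.
    by have := enormD (p - y) y; rewrite subrK; lra.
  have h1 : enorm (y - p) < d1 by rewrite enormBC; lra.
  have h2 : enorm (x - p) < d1.
    by apply: le_lt_trans (enorm_triangle y x p) _; rewrite (enormBC y p) (enormBC x y); lra.
  by have := hd1 p x y (conj pR np) h2 h1; lra.
have Ox : Om x by apply: ball_x; exact: eball_center.
have Oy : Om y by apply: ball_y; exact: eball_center.
have s1 : 0 < 1 - s by case/andP: s01; lra.
have p2 : 0 < 2 - 2 * s by lra.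
have e2 : 0 < gam / 8 / n * (1 - s) by rewrite mulr_gt0// divr_gt0// (divr_gt0 gam0).
(* [d] is chosen after [n], so that the singular parts, of size [n * th], are at most [gam / 8]. *)
have [rd rd0 hrd] := powR_le_near0 p2 e2.
pose d := Num.min d0 rd.
have dpos : 0 < d by rewrite lt_min d00.
have dd0 : d <= d0 by rewrite ge_min lexx.
pose th := d `^ (2 - 2 * s) / (1 - s).
have hth : n * th <= gam / 8.
  rewrite mulrC -ler_pdivlMr// /th ler_pdivrMr//; apply: hrd => //.
  by rewrite ge_min lexx orbT.
have sub_d p w : eball p d w -> eball p d0 w.
  by rewrite /eball/= => h; exact: lt_le_trans dd0.
have phiE p : quad n ((- (2 * n)) *: y) (n * dot y y) p = n * enorm (p - y) ^+ 2.
  by rewrite enorm_sqr /quad !dotE (dotC y p); ring.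
have psiE p : quad (- n) ((2 * n) *: x) (- (n * dot x x)) p = - (n * enorm (x - p) ^+ 2).
  by rewrite enorm_sqr /quad !dotE (dotC p x); ring.
(* The order matters: the supersolution supplies one nearly optimal direction [z], along which the
   subsolution inequality, valid in all directions, is then used. *)
have [|w hw|z z1 Ev] := super_b (x := y) (d := d) (al := - n) (c := - (n * dot x x))
  (k := (2 * n) *: x) dpos _ _ g4.
- by move=> w /sub_d; exact: ball_y.
- rewrite !psiE; have := xymin x w xR (OR _ (ball_y _ (sub_d _ _ hw))); lra.
have hball : eball x d `<=` Om by move=> w /sub_d; exact: ball_x.
have htest w : eball x d w -> - a w - quad n ((- (2 * n)) *: y) (n * dot y y) w <=
    - a x - quad n ((- (2 * n)) *: y) (n * dot y y) x.
  move=> hw; rewrite !phiE.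
  by have := xymin w y (OR _ (ball_x _ (sub_d _ _ hw))) yR; lra.
have Eu := sub_a dpos hball htest z1.
rewrite (Ezd_quad s01)// -/th in Ev.
rewrite (Ezd_quad s01)// -/th (tail_int_incrN s01 _ _ la aM (aM x) dpos) in Eu.
have Fa := incr_bounded x z aM (aM x); have Fb := incr_bounded y z bM (bM y).
have ma := measurable_incr (a x) x z la; have mb := measurable_incr (b y) y z lb.
set Ia := incr a _ _ _ in Fa ma Eu *; set Ib := incr b _ _ _ in Fb mb Ev *.
have mNa : measurable_fun setT (fun t => - Ia t) by exact: measurableT_comp.
have FNa t : `|- Ia t| <= 2 * M by rewrite normrN.
have mH : measurable_fun setT (fun t => - Ia t - Ib t) by exact: measurable_funB.
have HM t : `|- Ia t - Ib t| <= 4 * M.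
  by rewrite (le_trans (ler_normB _ _))//; have := FNa t; have := Fb t; lra.
have H_far t : - Ia t - Ib t <= 4 * M by have := HM t; rewrite ler_norml => /andP[].
have IE t : - Ia t - Ib t = (a x + b y) - (a (x + t *: z) + b (y + t *: z)).
  by rewrite /Ia /Ib /incr; ring.
have shift p p' t : p + t *: z - (p' + t *: z) = p - p'.
  by rewrite opprD addrACA subrr addr0.
have line_in p t : Om p -> `|t| < T -> enorm (p + t *: z) <= R0 + T.
  move=> /OR pR tT; apply: le_trans (enormD _ _) _.
  by rewrite enormZ z1 mulr1 lerD// ltW.
(* The translated pair is a competitor with the same difference, hence the same penalty. *)
have H_near t : `|t| < d0 -> - Ia t - Ib t <= 0.
  move=> td.
  have lin p : eball p d0 (p + t *: z).
    by rewrite /eball/= addrC addKr enormZ z1 mulr1.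
  have := xymin _ _ (OR _ (ball_x _ (lin x))) (OR _ (ball_y _ (lin y))).
  by rewrite shift IE; lra.
have H_mid t : `|t| < T -> - Ia t - Ib t <= eta.
  move=> tT; rewrite IE.
  have := hra _ (x + t *: z) (y + t *: z) (line_in _ _ Ox tT).
  by rewrite subrr enorm0 shift => /(_ ra0 (lt_le_trans xyr rra)); lra.
have H_out t : D <= `|t| -> `|t| < T -> - Ia t - Ib t <= eta - m.
  move=> Dt tT; rewrite IE.
  have nO : ~ Om (x + t *: z).
    move=> /OR h; have := enormD (x + t *: z) (- x).
    rewrite addrC addKr enormZ z1 mulr1 enormN.
    by have := OR _ Ox; rewrite /D in Dt; lra.
  have := hrb _ (x + t *: z) (y + t *: z) (conj (line_in _ _ Ox tT) nO).
  by rewrite subrr enorm0 shift => /(_ rb0 (lt_le_trans xyr rrb)); lra.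
have hI : tail_int s d (fun t => - Ia t - Ib t) <=
    (2 * eta * q d0 + (- (2 * m)) * q D + C * q T) / (2 * s).
  apply: (tail_int_le s0 dpos mH HM dd0 (le_trans dd0 d0D)
    (le_trans (le_trans dd0 d0D) DT)) => t dt.
  have t0 : 0 <= t by rewrite (le_trans (ltW dpos)).
  rewrite /tail_ind ger0_norm//.
  have tn : `|t| = t by rewrite ger0_norm.
  have tn' : `|- t| = t by rewrite normrN.
  have [h1|h1] := ltP t d0.
    rewrite (leNgt D) (lt_le_trans h1 d0D) (leNgt T).
    rewrite (lt_le_trans (lt_le_trans h1 d0D) DT)/=.
    have := H_near t; have := H_near (- t); rewrite tn tn' => /(_ h1) + /(_ h1); lra.
  have [h2|h2] := ltP t D.
    have h3 := lt_le_trans h2 DT; rewrite (leNgt T) h3/=.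
    have := H_mid t; have := H_mid (- t); rewrite tn tn' => /(_ h3) + /(_ h3); lra.
  have [h3|h3] := ltP t T.
    have := H_out t; have := H_out (- t); rewrite tn tn' /=.
    by move=> /(_ h2 h3) + /(_ h2 h3); lra.
  by have := H_far t; have := H_far (- t); rewrite /= /C; lra.
rewrite (tail_intB s0 dpos mNa FNa mb Fb) (tail_intN s0 dpos ma Fa) in hI.
have hg : (2 * eta * q d0 + (- (2 * m)) * q D + C * q T) / (2 * s) <= - gam.
  rewrite /gam -[leRHS]mulNr ler_pM2r ?invr_gt0//.
  by rewrite -(mulrA 2 eta) heta; lra.
(* Subtracting the inequalities leaves more than [- (gam / 4)], while the nonlocal terms give at
   most [- gam], the singular ones at most [gam / 4], and [f] less than [gam / 4]. *)
have hf := hrf x y (subset_closure Ox) (subset_closure Oy) (lt_le_trans xyr rrf).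
have hf' := hrf y x (subset_closure Oy) (subset_closure Ox).
rewrite enormBC in hf'; have {}hf' := hf' (lt_le_trans xyr rrf).
by lra.
Qed.

End Doubling.
End Comparison.

(** * Boundary inequalities for super- and subsolutions *)

Section Boundary.
Variables (R : realType) (N : nat) (s : R) (Om : set 'rV[R]_N).
Hypotheses (N0 : (0 < N)%N) (s01 : 0 < s < 1) (Om0 : Om !=set0) (oOm : open Om)
  (bOm : ebounded Om) (cOm : strictly_convex Om).
Notation V := 'rV[R]_N.

Variables (f g : V -> R) (M Mf : R).
Hypotheses (fM : forall x, closure Om x -> `|f x| <= Mf)
  (cg : {within closure (~` Om), continuous g})
  (gM : forall x, closure (~` Om) x -> `|g x| <= M).

(** At the barrier point [b y < g y] excludes the datum alternative on the boundary, so [Ed >= 0]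
    must hold, while all directions give [Ezd >= 1]. *)
Lemma supersolution_ge_datum (b : V -> R) : lsc b -> (forall x, `|b x| <= M) ->
  visc_super_lsc s Om f g b -> forall x, ~ Om x -> g x <= b x.
Proof.
move=> lb bM [bg hb] x0 nx0.
have [cx0|] := pselect (closure Om x0); last exact: bg.
rewrite leNgt; apply/negP => bgx0.
have [y [d [k [cy d0 test bgy E1]]]] :=
  boundary_barrier s01 Om0 oOm bOm cOm fM cg gM lb bM bg cx0 nx0 bgx0.
have [hO hB] := hb d (quad 0 k 0) y d0 (C2_quad _ _ _) test.
have : 0 <= Ed s f d (low_ext Om g b) (b y) (quad 0 k 0) y.
  have [Oy|Oy] := pselect (Om y); first exact: hO.
  have := hB (conj cy Oy); rewrite le_max => /orP[//|].
  by rewrite leNgt subr_lt0 bgy.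
move=> /(exists_Ezd_lt_of_Ed_ge0 N0)/(_ ltr01)[z z1].
by rewrite ltNge E1.
Qed.

End Boundary.

(** The operator is not odd: negation turns its infimum into a supremum. The barrier for [a], [- f],
    [- g] is an inequality in every direction, so it still contradicts the subsolution inequality,
    along any one direction. *)
Lemma subsolution_le_datum (R : realType) (N : nat) (s : R) (Om : set 'rV[R]_N)
    (f g a : 'rV[R]_N -> R) (M Mf : R) :
  (0 < N)%N -> 0 < s < 1 -> Om !=set0 -> open Om -> ebounded Om ->
  strictly_convex Om -> (forall x, closure Om x -> `|f x| <= Mf) ->
  {within closure (~` Om), continuous g} ->
  (forall x, closure (~` Om) x -> `|g x| <= M) ->
  lsc a -> (forall x, `|a x| <= M) ->
  visc_sub_usc s Om f g (fun x => - a x) -> forall x, ~ Om x -> - a x <= g x.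
Proof.
move=> N0 s01 Om0 oOm bOm cOm fM cg gM la aM [ag ha] x0 nx0.
have [cx0|] := pselect (closure Om x0); last exact: ag.
rewrite leNgt; apply/negP => agx0.
have cNg := within_continuousN cg.
have NfM x : closure Om x -> `|- f x| <= Mf by move=> /fM; rewrite normrN.
have NgM x : closure (~` Om) x -> `|- g x| <= M by move=> /gM; rewrite normrN.
have Nag x : ~ closure Om x -> - g x <= a x by move=> /ag; lra.
have Nagx0 : a x0 < - g x0 by lra.
have [y [d [k [cy d0 test bgy E1]]]] :=
  boundary_barrier s01 Om0 oOm bOm cOm NfM cNg NgM la aM Nag cx0 nx0 Nagx0.
pose A := low_ext Om (fun x => - g x) a.
have lA : lsc A by exact: lsc_low_ext.
have AM := low_ext_bounded aM NgM; rewrite -/A in AM.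
have quadN w : quad 0 (- k) 0 w = - quad 0 k 0 w by rewrite /quad dotNl; ring.
have test' w : eball y d w -> - a w - quad 0 (- k) 0 w <= - a y - quad 0 (- k) 0 y.
  by move=> /test; rewrite !quadN; lra.
have [hO hB] := ha d (quad 0 (- k) 0) y d0 (C2_quad _ _ _) test'.
rewrite up_ext_opp -/A in hO hB.
have hE : Ed s f d (fun x => - A x) (- a y) (quad 0 (- k) 0) y <= 0.
  have [Oy|Oy] := pselect (Om y); first exact: hO.
  have := hB (conj cy Oy); rewrite ge_min => /orP[//|].
  by have := bgy Oy; lra.
have [z z1] := sphere_neq0 R N0.
have := Ezd_ge0_of_Ed_le0 s01 lA AM (aM y) d0 hE z1.
have := E1 z z1; rewrite !Ezd_quad// -/A !mul0r !add0r.
by rewrite (tail_int_incrN s01 _ _ lA AM (aM y) d0); lra.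
Qed.

(** * Assembly of the comparison principle *)

Theorem theorem2p2 (R : realType) (N : nat) (s : R) (Om : set 'rV[R]_N)
    (f g u v : 'rV[R]_N -> R) :
  (0 < N)%N -> 0 < s < 1 ->
  bounded_C2_domain Om -> strictly_convex Om ->
  {within closure Om, continuous f} -> bounded_on (closure Om) f ->
  {within closure (~` Om), continuous g} -> bounded_on (closure (~` Om)) g ->
  visc_subsolution s Om f g u -> visc_supersolution s Om f g v ->
  forall x, u x <= v x.
Proof.
move=> N0 s01 [Om0 [oOm [_ [bOm _]]]] cOm cf [Mf fM] cg [Mg gM].
move=> [[Mu uM] hu] [[Mv vM] hv] x.
pose M := Num.max Mg (Num.max Mu Mv).
have {}gM y : closure (~` Om) y -> `|g y| <= M.
  by move=> /gM; rewrite le_max => ->.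
have {}uM y : `|- u y| <= M.
  by rewrite normrN !le_max uM ?orbT.
have {}vM y : `|v y| <= M by rewrite !le_max vM ?orbT.
(* With [- u] in place of [u] both functions are lower semicontinuous, and the aim becomes
   nonnegativity of a sum. *)
pose a := lsc_env (fun y => - u y); pose b := lsc_env v.
have uE : usc_env u = (fun y => - a y).
  by apply/funext => y; rewrite usc_envE.
rewrite uE -/b in hu hv.
have la : lsc a by exact: lsc_lsc_env uM.
have lb : lsc b by exact: lsc_lsc_env vM.
have aM : forall y, `|a y| <= M by exact: lsc_env_bounded uM.
have bM : forall y, `|b y| <= M by exact: lsc_env_bounded vM.
have ag := subsolution_le_datum N0 s01 Om0 oOm bOm cOm fM cg gM la aM hu.
have bg := supersolution_ge_datum N0 s01 Om0 oOm bOm cOm fM cg gM lb bM hv.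
have cNg := within_continuousN cg.
have NgM y : closure (~` Om) y -> `|- g y| <= M by move=> /gM; rewrite normrN.
pose A := low_ext Om (fun y => - g y) a; pose B := low_ext Om g b.
have lA : lsc A by exact: lsc_low_ext.
have lB : lsc B by exact: lsc_low_ext.
have AM : forall y, `|A y| <= M by exact: low_ext_bounded.
have BM : forall y, `|B y| <= M by exact: low_ext_bounded.
have A_in y : Om y -> A y = a y by exact: low_ext_in.
have B_in y : Om y -> B y = b y by exact: low_ext_in.
(* The boundary inequality reduces the minimum in the extension to the datum, so [A] and [B] cancel
   outside [Om]. *)
have A_out y : ~ Om y -> A y = - g y.
  move=> ny; have [cy|cy] := pselect (closure Om y); last exact: low_ext_out.
  by rewrite /A low_ext_bd// min_r//; have := ag _ ny; lra.
have B_out y : ~ Om y -> B y = g y.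
  move=> ny; have [cy|cy] := pselect (closure Om y); last exact: low_ext_out.
  by rewrite /B low_ext_bd// min_r//; exact: bg.
have AB : 0 <= A x + B x.
  apply: (doubling s01 oOm bOm cf lA lB AM BM) => {x}.
  - by move=> x nx; rewrite A_out// B_out//; lra.
  - move=> x d al c k d0 xOm test z z1.
    have Ox : Om x by apply: xOm; exact: eball_center.
    (* Inside [Om] the extensions agree with the envelopes, so touching conditions on small balls
       transfer. *)
    have test' y : eball x d y -> - a y - quad al k c y <= - a x - quad al k c x.
      by move=> xy; rewrite -!A_in//; [exact: test|exact: xOm].
    have [/(_ Ox) + _] := hu.2 d (quad al k c) x d0 (C2_quad _ _ _) test'.
    rewrite up_ext_opp -/A A_in// => hE.
    exact: (Ezd_ge0_of_Ed_le0 s01 lA AM (aM x) d0 hE z1).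
  - move=> x d al c k eta d0 xOm test eta0.
    have Ox : Om x by apply: xOm; exact: eball_center.
    have test' y : eball x d y -> b x - quad al k c x <= b y - quad al k c y.
      by move=> xy; rewrite -!B_in//; [exact: test|exact: xOm].
    have [/(_ Ox) + _] := hv.2 d (quad al k c) x d0 (C2_quad _ _ _) test'.
    rewrite B_in// => hE.
    exact: (exists_Ezd_lt_of_Ed_ge0 N0 hE eta0).
have ux : - a x >= u x by have := lsc_env_le uM x; rewrite -/a; lra.
have vx : b x <= v x by exact: lsc_env_le vM x.
have [Ox|nx] := pselect (Om x); first by move: AB; rewrite A_in// B_in//; lra.
by have := ag _ nx; have := bg _ nx; lra.
Qed.
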